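(* Let $K$ be a field, $E$ a directed graph and $L=L_K(E)$. The following are equivalent. (1) Every proper ideal of $L$ is a product of (finitely many) semiprime ideals. (2) For every ideal $I$ of $L$, $I/\mathrm{gr}(I)$ is finitely generated. (3) Given any hereditary saturated subset $H$ of $E^0$, there are only finitely many cycles $c$ in $E$ with the property that $\{c^0\}\cap H=\emptyset$ and $r(e)\in H$ for all exits $e$ of $c$.
   Context: Graphs: $E=(E^0,E^1,r,s)$ with $E^0\neq\emptyset$, $r,s:E^1\to E^0$, no cardinality restrictions. A path is a finite sequence $e_1\cdots e_n$ of edges with $r(e_i)=s(e_{i+1})$; $\{\mu^0\}$ is the set of vertices on $\mu$. A cycle is a path with $r(e_n)=s(e_1)$ and $s(e_i)\ne s(e_j)$ for $i\ne j$ (cycles are distinguished by their sets of edges); an exit of $e_1\cdots e_n$ is an edge $f\notin\{e_1,\dots,e_n\}$ with $s(f)=s(e_i)$ for some $i$. A vertex $v$ is regular if $s^{-1}(v)$ is finite nonempty, an infinite emitter if $s^{-1}(v)$ is infinite. $H\subseteq E^0$ is hereditary if $u\in H$ and a path from $u$ to $v$ imply $v\in H$; saturated if every regular $v$ with $r(s^{-1}(v))\subseteq H$ lies in $H$. The Leavitt path algebra $L_K(E)$ is generated by $\{v:v\in E^0\}\cup\{e,e^*:e\in E^1\}$ with relations $vw=\delta_{v,w}v$; $s(e)e=er(e)=e$; $r(e)e^*=e^*s(e)=e^*$; $e^*f=\delta_{e,f}r(e)$; $v=\sum_{e\in s^{-1}(v)}ee^*$ for regular $v$. For an ideal (two-sided)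 $I$, let $H=I\cap E^0$, $B_H$ the set of infinite emitters $w\notin H$ with $0<|s^{-1}(w)\cap r^{-1}(E^0\setminus H)|<\infty$, $v^H:=v-\sum_{s(e)=v,\,r(e)\notin H}ee^*$, $S=\{v\in B_H:v^H\in I\}$; the graded part $\mathrm{gr}(I)$ is the ideal generated by $H\cup\{v^H:v\in S\}$. A proper ideal $J$ is semiprime if $A^2\subseteq J$ for an ideal $A$ implies $A\subseteq J$; a product of semiprime ideals includes the case of a single semiprime ideal. *)

(* Defs.v *)
From HB Require Import structures.
From mathcomp Require Import all_boot all_order all_algebra.
From Stdlib Require List.
Set Implicit Arguments. Unset Strict Implicit. Unset Printing Implicit Defensive.
Import GRing.Theory.
Local Open Scope ring_scope.

(* Associative, not necessarily unital K-algebras (L_K(E) is unital only when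
   E^0 is finite). *)
Record nalg (K : fieldType) := NAlg {
  nacar :> lmodType K;
  namul : nacar -> nacar -> nacar;
  namulA : forall x y z, namul x (namul y z) = namul (namul x y) z;
  namulDl : forall x y z, namul (x + y) z = namul x z + namul y z;
  namulDr : forall x y z, namul x (y + z) = namul x y + namul x z;
  namulZl : forall (a : K) x y, namul (a *: x) y = a *: namul x y;
  namulZr : forall (a : K) x y, namul x (a *: y) = a *: namul x y
}.

Definition fin_set (T : Type) (P : T -> Prop) : Prop :=
  exists l : seq T, forall x, P x -> List.In x l.

Section Graph.
Variables (E0 E1 : Type) (r s : E1 -> E0).

Fixpoint chain (p : seq E1) : Prop :=
  match p with
  | e :: ((f :: _) as q) => r e = s f /\ chain q
  | _ => True
  end.

Definition path_st (u v : E0) (p : seq E1) : Prop :=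
  match p with
  | [::] => False
  | e :: p' => chain p /\ s e = u /\ r (last e p') = v
  end.

Definition hereditary (H : E0 -> Prop) : Prop :=
  forall u v p, H u -> path_st u v p -> H v.

Definition regular (v : E0) : Prop :=
  fin_set (fun e => s e = v) /\ exists e, s e = v.

Definition infinite_emitter (v : E0) : Prop := ~ fin_set (fun e => s e = v).

Definition saturated (H : E0 -> Prop) : Prop :=
  forall v, regular v -> (forall e, s e = v -> H (r e)) -> H v.

Definition is_cycle (c : seq E1) : Prop :=
  match c with
  | [::] => False
  | e :: c' => chain c /\ r (last e c') = s e
  end /\ List.NoDup (map s c).

Definition exit_of (c : seq E1) (f : E1) : Prop :=
  ~ List.In f c /\ exists e, List.In e c /\ s f = s e.

Definition same_cycle (c c' : seq E1) : Prop :=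
  forall e, List.In e c <-> List.In e c'.

Definition qual_cycle (H : E0 -> Prop) (c : seq E1) : Prop :=
  is_cycle c /\ (forall e, List.In e c -> ~ H (s e) /\ ~ H (r e)) /\
  (forall f, exit_of c f -> H (r f)).

Definition cond3 : Prop :=
  forall H : E0 -> Prop, hereditary H -> saturated H ->
    exists cs : seq (seq E1),
      forall c, qual_cycle H c -> exists c', List.In c' cs /\ same_cycle c c'.

Section Alg.
Variables (K : fieldType).

Definition lp_rel (B : nalg K) (fv : E0 -> B) (fe fes : E1 -> B) : Prop :=
  (forall v, namul (fv v) (fv v) = fv v) /\
  (forall v w, v <> w -> namul (fv v) (fv w) = 0) /\
  (forall e, namul (fv (s e)) (fe e) = fe e /\ namul (fe e) (fv (r e)) = fe e) /\
  (forall e, namul (fv (r e)) (fes e) = fes e /\ namul (fes e) (fv (s e)) = fes e) /\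
  (forall e, namul (fes e) (fe e) = fv (r e)) /\
  (forall e f, e <> f -> namul (fes e) (fe f) = 0) /\
  (forall v (l : seq E1), regular v -> List.NoDup l ->
     (forall e, List.In e l <-> s e = v) ->
     fv v = \sum_(e <- l) namul (fe e) (fes e)).

Definition alg_hom (A B : nalg K) (phi : A -> B) : Prop :=
  (forall (a : K) (x y : A), phi (a *: x + y) = a *: phi x + phi y) /\
  (forall x y : A, phi (namul x y) = namul (phi x) (phi y)).

Definition is_LPA (A : nalg K) (v : E0 -> A) (e es : E1 -> A) : Prop :=
  lp_rel v e es /\
  forall (B : nalg K) (v' : E0 -> B) (e' es' : E1 -> B), lp_rel v' e' es' ->
    (exists phi : A -> B, alg_hom phi /\ (forall x, phi (v x) = v' x) /\
        (forall x, phi (e x) = e' x) /\ (forall x, phi (es x) = es' x)) /\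
    (forall phi psi : A -> B, alg_hom phi -> alg_hom psi ->
        (forall x, phi (v x) = psi (v x)) -> (forall x, phi (e x) = psi (e x)) ->
        (forall x, phi (es x) = psi (es x)) -> forall y, phi y = psi y).

Variables (A : nalg K) (v : E0 -> A) (e es : E1 -> A).

Definition is_ideal (I : A -> Prop) : Prop :=
  I 0 /\ (forall x y, I x -> I y -> I (x - y)) /\
  (forall a x, I x -> I (namul a x) /\ I (namul x a)).

Definition gen (S : A -> Prop) (x : A) : Prop :=
  forall J, is_ideal J -> (forall y, S y -> J y) -> J x.

Definition iprod (I J : A -> Prop) : A -> Prop :=
  gen (fun z => exists x y, I x /\ J y /\ z = namul x y).

Definition proper (I : A -> Prop) : Prop := exists x, ~ I x.
Definition seteq (I J : A -> Prop) : Prop := forall x, I x <-> J x.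
Definition subset (I J : A -> Prop) : Prop := forall x, I x -> J x.

Definition semiprime (I : A -> Prop) : Prop :=
  is_ideal I /\ proper I /\
  forall J, is_ideal J -> subset (iprod J J) I -> subset J I.

Definition prod_semiprimes (I : A -> Prop) : Prop :=
  exists J (Js : seq (A -> Prop)), semiprime J /\
    (forall J', List.In J' Js -> semiprime J') /\ seteq I (foldl iprod J Js).

Definition cond1 : Prop :=
  forall I, is_ideal I -> proper I -> prod_semiprimes I.

Definition BH (H : E0 -> Prop) (w : E0) : Prop :=
  infinite_emitter w /\ ~ H w /\
  fin_set (fun f => s f = w /\ ~ H (r f)) /\ exists f, s f = w /\ ~ H (r f).

Definition is_vH (H : E0 -> Prop) (w : E0) (y : A) : Prop :=
  exists l : seq E1, List.NoDup l /\
    (forall f, List.In f l <-> s f = w /\ ~ H (r f)) /\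
    y = v w - \sum_(f <- l) namul (e f) (es f).

Definition gr (I : A -> Prop) : A -> Prop :=
  let H := fun u => I (v u) in
  gen (fun y => (exists u, H u /\ y = v u) \/
                (exists w, BH H w /\ is_vH H w y /\ I y)).

Definition cond2 : Prop :=
  forall I, is_ideal I ->
    exists xs : seq A, (forall x, List.In x xs -> I x) /\
      seteq I (gen (fun y => gr I y \/ List.In y xs)).

End Alg.
End Graph.

(* Main.v *)
(* Write H for the vertices of an ideal I, call a cycle c qualified if it avoids H and
   all its exits end in H, and write F(c) for the value at c of a polynomial F.

   The key point is that I is generated by gr(I) and the elements F(c) of I with c
   qualified.  Indeed, if x in I is not in the ideal J generated by these, multiplying x
   on the right by edges lowers the ghost degree without entering J, unless x agrees
   modulo J with p v^H for a real combination p, which forces v^H into I.  A real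
   combination is brought, by ghost edges on the left, to the form k w + sum k_i g_i with
   k <> 0 and closed paths g_i at w.  Since it lies in I, every path m from w ending
   outside H is a prefix of some g_i m.  So all of these paths follow one periodic path,
   whose primitive period is a qualified cycle c, and the combination is some F(c).

   Conversely, a qualified cycle c and a polynomial g with g(0) <> 0 give a twisted Chen
   module, on functions of the infinite paths that end in c, with values taken modulo g.
   Its annihilator contains F(c) exactly when g divides F, and contains H, the v^H and
   every other qualified cycle.  This separates the cycles from each other.

   With K[x] principal, (3) => (2) follows.  For (3) => (1), factor the generator p_c of
   {F | F(c) in I} into polynomials q with q | F^2 => q | F; by finiteness there is a
   common bound on the number of factors, and the ideals generated by gr(I) and one factor
   for each c are semiprime (or everything) and have product I.  If (3) fails for H, then
   H and all (x - 1)(c) generate a counterexample to (2); H and (x - 1)^(2^k)(c_k), for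
   inequivalent cycles c_k, generate a counterexample to (1), because a semiprime ideal
   containing a power of (x - 1)(c) contains (x - 1)(c). *)
Require Import Defs.
From HB Require Import structures.
From mathcomp Require Import all_boot all_order all_algebra.
From mathcomp Require Import boolp functions.
Set Implicit Arguments. Unset Strict Implicit. Unset Printing Implicit Defensive.
Import GRing.Theory.
Local Open Scope ring_scope.
Notation "x ** y" := (namul x y) (at level 40, left associativity).

(** * Subalgebras *)

Section SubAlgebra.
Variables (K : fieldType) (U : lmodType K) (mul : U -> U -> U) (P : U -> Prop).
Hypothesis P0 : P 0.
Hypothesis PD : forall k x y, P x -> P y -> P (k *: x + y).
Hypothesis PM : forall x y, P x -> P y -> P (mul x y).
Hypothesis MA : forall x y z, P x -> P y -> P z -> mul x (mul y z) = mul (mul x y) z.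
Hypothesis MDl : forall k x y z, P x -> P y -> P z ->
  mul (k *: x + y) z = k *: mul x z + mul y z.
Hypothesis MDr : forall k x y z, P x -> P y -> P z ->
  mul x (k *: y + z) = k *: mul x y + mul x z.

Definition sub_pred : {pred U} := fun x => `[< P x >].

Lemma sub_predP x : reflect (P x) (x \in sub_pred).
Proof. exact: asboolP. Qed.

Lemma sub_pred_closed : submod_closed sub_pred.
Proof.
split; first exact/sub_predP.
by move=> k x y /sub_predP Px /sub_predP Py; apply/sub_predP/PD.
Qed.

HB.instance Definition _ :=
  GRing.isSubmodClosed.Build K U sub_pred sub_pred_closed.

Record sub_car := SubCar { sub_val : U; sub_valP : sub_val \in sub_pred }.

HB.instance Definition _ := [isSub for sub_val].
HB.instance Definition _ := [Choice of sub_car by <:].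
HB.instance Definition _ := [SubChoice_isSubLmodule of sub_car by <:].

Lemma sub_valPP (x : sub_car) : P (val x).
Proof. exact/sub_predP/valP. Qed.

Definition sub_mul (x y : sub_car) : sub_car :=
  SubCar (introT (sub_predP _) (PM (sub_valPP x) (sub_valPP y))).

Lemma sub_mulA x y z : sub_mul x (sub_mul y z) = sub_mul (sub_mul x y) z.
Proof. by apply/val_inj; rewrite /= MA //; apply: sub_valPP. Qed.
Lemma sub_mulDl x y z : sub_mul (x + y) z = sub_mul x z + sub_mul y z.
Proof.
apply/val_inj; rewrite /= -[val x in LHS]scale1r.
by rewrite MDl ?scale1r //; apply: sub_valPP.
Qed.
Lemma sub_mulDr x y z : sub_mul x (y + z) = sub_mul x y + sub_mul x z.
Proof.
apply/val_inj; rewrite /= -[val y in LHS]scale1r.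
by rewrite MDr ?scale1r //; apply: sub_valPP.
Qed.
Lemma sub_mul0l z : P z -> mul 0 z = 0.
Proof.
move=> Pz; have := MDl (-1) P0 P0 Pz.
by rewrite scaleN1r oppr0 add0r scaleN1r addNr.
Qed.
Lemma sub_mul0r z : P z -> mul z 0 = 0.
Proof.
move=> Pz; have := MDr (-1) Pz P0 P0.
by rewrite scaleN1r oppr0 add0r scaleN1r addNr.
Qed.
Lemma sub_mulZl a x y : sub_mul (a *: x) y = a *: sub_mul x y.
Proof.
apply/val_inj; rewrite /= -[X in mul X]addr0 MDl ?sub_mul0l ?addr0 //;
  exact: sub_valPP.
Qed.
Lemma sub_mulZr a x y : sub_mul x (a *: y) = a *: sub_mul x y.
Proof.
apply/val_inj; rewrite /= -[X in mul _ X]addr0 MDr ?sub_mul0r ?addr0 //;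
  exact: sub_valPP.
Qed.

(** Associativity and bilinearity are assumed on [P] only, because composition of arbitrary maps
    [V -> V] is linear in its right factor only when the left factor is linear. The construction
    serves both for subalgebras of [A] and for algebras of linear operators. *)
Definition sub_nalg : nalg K :=
  NAlg sub_mulA sub_mulDl sub_mulDr sub_mulZl sub_mulZr.

Definition sub_in x (Px : P x) : sub_nalg := SubCar (introT (sub_predP _) Px).

Lemma sub_val_sum (T : Type) (l : seq T) (F : T -> sub_car) :
  sub_val (\sum_(i <- l) F i) = \sum_(i <- l) sub_val (F i).
Proof. exact: (raddf_sum (val : sub_car -> U)). Qed.

End SubAlgebra.

(** * Lists as finite sets *)

Lemma In_mem (T : eqType) (x : T) (l : seq T) : List.In x l <-> x \in l.
Proof.
elim: l => [|y l IH] //=; rewrite in_cons; split.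
  by move=> [->|/IH ->]; rewrite ?eqxx ?orbT.
by case/orP => [/eqP ->|/IH]; [left | right].
Qed.

Lemma NoDup_uniq (T : eqType) (l : seq T) : List.NoDup l <-> uniq l.
Proof.
elim: l => [|y l IH] /=; first by split=> // _; constructor.
split; first by move=> h; inversion h as [|? ? h1 h2]; subst; apply/andP; split;
  [apply/negP => /In_mem | apply/IH].
by case/andP => /negP h1 /IH h2; constructor => // /In_mem.
Qed.

Lemma fin_set_seq (T : eqType) (P : T -> Prop) :
  fin_set P <-> exists l : seq T, uniq l /\ forall x, P x <-> x \in l.
Proof.
split=> [[l Hl]|[l [_ Hl]]]; last by exists l => x /Hl /In_mem.
exists (undup [seq x <- l | `[< P x >]]); split; first exact: undup_uniq.
move=> x; rewrite mem_undup mem_filter; split.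
  by move=> Px; rewrite (introT (asboolP _) Px) /=; apply/In_mem/Hl.
by case/andP => /asboolP.
Qed.

(** * Ideals of a non-unital algebra *)

Section Algebra.
Variables (K : fieldType) (A : nalg K).
Implicit Types (x y z : A) (I J : A -> Prop).

Lemma namul0l x : 0 ** x = 0.
Proof. by rewrite -(scale0r (0 : A)) namulZl !scale0r. Qed.
Lemma namul0r x : x ** 0 = 0.
Proof. by rewrite -(scale0r (0 : A)) namulZr !scale0r. Qed.
Lemma namulNl x y : (- x) ** y = - (x ** y).
Proof. by rewrite -scaleN1r namulZl scaleN1r. Qed.
Lemma namulNr x y : x ** (- y) = - (x ** y).
Proof. by rewrite -scaleN1r namulZr scaleN1r. Qed.
Lemma namulBl x y z : (x - y) ** z = x ** z - y ** z.
Proof. by rewrite namulDl namulNl. Qed.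
Lemma namulBr x y z : z ** (x - y) = z ** x - z ** y.
Proof. by rewrite namulDr namulNr. Qed.
Lemma namul_suml (T : Type) (l : seq T) (P : pred T) (F : T -> A) y :
  (\sum_(i <- l | P i) F i) ** y = \sum_(i <- l | P i) F i ** y.
Proof.
exact: (big_morph (fun x => x ** y) (fun a b => namulDl a b y) (namul0l y)).
Qed.
Lemma namul_sumr (T : Type) (l : seq T) (P : pred T) (F : T -> A) y :
  y ** (\sum_(i <- l | P i) F i) = \sum_(i <- l | P i) y ** F i.
Proof.
exact: (big_morph (fun x => y ** x) (fun a b => namulDr y a b) (namul0r y)).
Qed.

Section Ideal.
Variables (I : A -> Prop) (hI : is_ideal I).
Lemma ideal0 : I 0. Proof. by case: hI. Qed.
Lemma idealB x y : I x -> I y -> I (x - y).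
Proof. by case: hI => _ [h _]; apply: h. Qed.
Lemma idealN x : I x -> I (- x).
Proof. by move=> Ix; rewrite -sub0r; exact: (idealB ideal0). Qed.
Lemma idealD x y : I x -> I y -> I (x + y).
Proof. by move=> Ix Iy; rewrite -(opprK y); exact: (idealB Ix (idealN Iy)). Qed.
Lemma idealMl x y : I x -> I (y ** x).
Proof. by case: hI => _ [_ h] Ix; case: (h y x Ix). Qed.
Lemma idealMr x y : I x -> I (x ** y).
Proof. by case: hI => _ [_ h] Ix; case: (h y x Ix). Qed.
Lemma ideal_sum (T : eqType) (l : seq T) (F : T -> A) :
  (forall i, i \in l -> I (F i)) -> I (\sum_(i <- l) F i).
Proof.
elim: l => [|i l IH] h; first by rewrite big_nil; apply: ideal0.
rewrite big_cons; apply: idealD; first by apply: h; rewrite mem_head.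
by apply: IH => j jl; apply: h; rewrite in_cons jl orbT.
Qed.
Lemma idealBr x y : I y -> I (x - y) -> I x.
Proof. by move=> Iy Ixy; rewrite -(subrK y x); apply: idealD. Qed.
End Ideal.

Lemma gen_ideal (S : A -> Prop) : is_ideal (gen S).
Proof.
split; [|split].
- by move=> J hJ _; exact: (ideal0 hJ).
- by move=> x y hx hy J hJ hS; exact: (idealB hJ (hx J hJ hS) (hy J hJ hS)).
- move=> a x hx; split => J hJ hS; [apply: (idealMl hJ) | apply: (idealMr hJ)]; exact: hx.
Qed.
Lemma gen_sub (S : A -> Prop) x : S x -> gen S x.
Proof. by move=> Sx J _; apply. Qed.
Lemma gen_min (S J : A -> Prop) : is_ideal J -> Defs.subset S J -> Defs.subset (gen S) J.
Proof. by move=> hJ hS x; apply. Qed.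

(** The elements reached with finitely many [G t] form an ideal, since two lists can be
    concatenated. *)
Lemma gen_finite (T : Type) (S : A -> Prop) (G : T -> A) x :
  gen (fun y => S y \/ exists t, y = G t) x ->
  exists l : seq T, gen (fun y => S y \/ exists2 t, List.In t l & y = G t) x.
Proof.
move=> /(_ (fun x => exists l : seq T,
  gen (fun y => S y \/ exists2 t, List.In t l & y = G t) x)); apply.
- split; [|split].
  + by exists [::]; exact: (ideal0 (gen_ideal _)).
  + move=> x1 x2 [l1 h1] [l2 h2]; exists (l1 ++ l2).
    apply: (idealB (gen_ideal _)).
      apply: gen_min h1; first exact: gen_ideal.
      move=> y [Sy|[t tl ->]]; apply: gen_sub; [by left | right].
      by exists t => //; apply: List.in_or_app; left.
    apply: gen_min h2; first exact: gen_ideal.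
    move=> y [Sy|[t tl ->]]; apply: gen_sub; [by left | right].
    by exists t => //; apply: List.in_or_app; right.
  + move=> a y [l hl]; split; exists l.
      exact: (idealMl (gen_ideal _)).
    exact: (idealMr (gen_ideal _)).
- move=> y [Sy|[t ->]]; first by exists [::]; apply: gen_sub; left.
  by exists [:: t]; apply: gen_sub; right; exists t => //=; left.
Qed.

Lemma gen_finite_seq (T : Type) (S : A -> Prop) (G : T -> A) (xs : seq A) :
  (forall x, List.In x xs -> gen (fun y => S y \/ exists t, y = G t) x) ->
  exists l : seq T, forall x, List.In x xs ->
    gen (fun y => S y \/ exists2 t, List.In t l & y = G t) x.
Proof.
elim: xs => [|x xs IH] h; first by exists [::].
have [l1 h1] := gen_finite (h x (or_introl erefl)).
have [l2 h2] := IH (fun y hy => h y (or_intror hy)).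
exists (l1 ++ l2) => y [<-|/h2 h2'].
  apply: gen_min h1; first exact: gen_ideal.
  move=> z [Sz|[t tl ->]]; apply: gen_sub; [by left | right].
  by exists t => //; apply: List.in_or_app; left.
apply: gen_min h2'; first exact: gen_ideal.
move=> z [Sz|[t tl ->]]; apply: gen_sub; [by left | right].
by exists t => //; apply: List.in_or_app; right.
Qed.

Lemma iprod_ideal I J : is_ideal (iprod I J).
Proof. exact: gen_ideal. Qed.
Lemma iprodM I J x y : I x -> J y -> iprod I J (x ** y).
Proof. by move=> Ix Jy; apply: gen_sub; exists x, y. Qed.

Lemma iprod_genS (S T Q : A -> Prop) : is_ideal Q ->
  (forall x y, S x -> T y -> Q (x ** y)) ->
  (forall x y z, S x -> T y -> Q (x ** z ** y)) ->
  Defs.subset (iprod (gen S) (gen T)) Q.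
Proof.
move=> hQ h1 h2.
(* The elements [y] with [S y] and [S A y] in [Q] form an ideal containing [T]. *)
have hT : forall y, gen T y -> forall x, S x -> Q (x ** y) /\ forall z, Q (x ** z ** y).
  move=> y /(_ (fun y => forall x, S x -> Q (x ** y) /\ forall z, Q (x ** z ** y))).
  apply; last by move=> y' Ty' x Sx; split; [apply: h1 | move=> z; apply: h2].
  split; [|split].
  - by move=> x Sx; split => [|z]; rewrite ?namul0r; exact: (ideal0 hQ).
  - move=> y1 y2 k1 k2 x Sx; split => [|z]; rewrite namulBr; apply: (idealB hQ);
      by [case: (k1 x Sx) | case: (k2 x Sx)].
  - move=> a y' k; split => x Sx; have [k1 k2] := k x Sx; (split; [|move=> z]).
    + by rewrite namulA.
    + by rewrite namulA -(namulA x); apply: k2.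
    + by rewrite namulA; apply: (idealMr hQ).
    + by rewrite namulA; apply: (idealMr hQ).
have hS : forall x, gen S x -> forall y, gen T y -> Q (x ** y).
  move=> x /(_ (fun x => forall y, gen T y -> Q (x ** y))); apply; last first.
    by move=> x' Sx' y /hT /(_ x' Sx') [].
  split; [|split].
  - by move=> y _; rewrite namul0l; exact: (ideal0 hQ).
  - move=> x1 x2 k1 k2 y Ty; rewrite namulBl; apply: (idealB hQ); [exact: k1 | exact: k2].
  - move=> a x' k; split => y Ty; first by rewrite -namulA; apply: (idealMl hQ); apply: k.
    by rewrite -namulA; apply: k; exact: (idealMl (gen_ideal _)).
apply: gen_min => // z [x [y [Sx [Ty ->]]]]; exact: hS.
Qed.

Lemma iprod_subl I J : is_ideal I -> Defs.subset (iprod I J) I.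
Proof. by move=> hI; apply: gen_min => // z [x [y [Ix [_ ->]]]]; exact: idealMr. Qed.
Lemma iprod_subr I J : is_ideal J -> Defs.subset (iprod I J) J.
Proof. by move=> hJ; apply: gen_min => // z [x [y [_ [Jy ->]]]]; apply: idealMl. Qed.
Lemma iprod_mono I I' J J' :
  Defs.subset I I' -> Defs.subset J J' -> Defs.subset (iprod I J) (iprod I' J').
Proof.
move=> h1 h2; apply: gen_min; first exact: iprod_ideal.
by move=> z [x [y [Ix [Jy ->]]]]; apply: iprodM; [apply: h1 | apply: h2].
Qed.

Lemma seteq_iprod I I' J J' :
  seteq I I' -> seteq J J' -> seteq (iprod I J) (iprod I' J').
Proof. by move=> h1 h2 x; split; apply: iprod_mono => y; [move/h1 | move/h2 | move/h1 | move/h2]. Qed.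
Lemma seteq_trans I I' J : seteq I I' -> seteq I' J -> seteq I J.
Proof. by move=> h1 h2 x; split => [/h1/h2|/h2/h1]. Qed.
Lemma foldl_iprod_ideal I Js : is_ideal I -> is_ideal (foldl (@iprod K A) I Js).
Proof. by elim: Js I => //= J Js IH I _; apply/IH/iprod_ideal. Qed.

Lemma foldl_iprod_sub0 I Js : is_ideal I -> Defs.subset (foldl (@iprod K A) I Js) I.
Proof.
elim: Js I => //= [|J Js IH] I hI x; first by [].
by move/(IH _ (iprod_ideal _ _)); apply: iprod_subl.
Qed.
Lemma foldl_iprod_sub I J Js : (forall J', List.In J' Js -> is_ideal J') ->
  List.In J Js -> Defs.subset (foldl (@iprod K A) I Js) J.
Proof.
elim: Js I => //= J1 Js IH I hJs [<-|JJs] x; last first.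
  by apply: IH => // J' hJ'; apply: hJs; right.
move/(foldl_iprod_sub0 (iprod_ideal _ _)); apply: iprod_subr.
by apply: hJs; left.
Qed.

End Algebra.

(** * Monomials of a Leavitt path algebra *)

Section Paths.
Variables (E0 E1 : eqType) (r s : E1 -> E0).
Implicit Types (u w : E0) (f g : E1) (p q : seq E1).

(* Paths are sequences of edges together with a source, needed for the empty path. *)
Fixpoint walk u p : bool := if p is f :: q then (s f == u) && walk (r f) q else true.
Definition endpt u p : E0 := last u (map r p).

Lemma walk_cat u p q : walk u (p ++ q) = walk u p && walk (endpt u p) q.
Proof. by elim: p u => //= f p IH u; rewrite IH andbA. Qed.
Lemma endpt_cat u p q : endpt u (p ++ q) = endpt (endpt u p) q.
Proof. by rewrite /endpt map_cat last_cat. Qed.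
Lemma endpt_rcons u p f : endpt u (rcons p f) = r f.
Proof. by rewrite /endpt map_rcons last_rcons. Qed.
End Paths.

Section LPA.
Variables (K : fieldType) (E0 E1 : eqType) (r s : E1 -> E0).
Variables (A : nalg K) (v : E0 -> A) (e es : E1 -> A).
Hypothesis hL : is_LPA r s v e es.
Implicit Types (u w : E0) (f g : E1) (p q : seq E1) (x y z : A).
Notation walk := (walk r s).
Notation endpt := (endpt r).

Lemma vv u : v u ** v u = v u. Proof. by case: hL => -[h _] _. Qed.
Lemma vw u w : u != w -> v u ** v w = 0.
Proof. by move/eqP => uw; case: hL => -[_ [h _]] _; apply: h. Qed.
Lemma vse f : v (s f) ** e f = e f.
Proof. by case: hL => -[_ [_ [h _]]] _; case: (h f). Qed.
Lemma evr f : e f ** v (r f) = e f.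
Proof. by case: hL => -[_ [_ [h _]]] _; case: (h f). Qed.
Lemma vre f : v (r f) ** es f = es f.
Proof. by case: hL => -[_ [_ [_ [h _]]]] _; case: (h f). Qed.
Lemma esv f : es f ** v (s f) = es f.
Proof. by case: hL => -[_ [_ [_ [h _]]]] _; case: (h f). Qed.
Lemma ese f : es f ** e f = v (r f).
Proof. by case: hL => -[_ [_ [_ [_ [h _]]]]] _; exact: h. Qed.
Lemma ese0 f g : f != g -> es f ** e g = 0.
Proof. by move/eqP => fg; case: hL => -[_ [_ [_ [_ [_ [h _]]]]]] _; apply: h. Qed.
Lemma CK2 u (l : seq E1) : regular s u -> uniq l -> (forall f, (f \in l) = (s f == u)) ->
  v u = \sum_(f <- l) e f ** es f.
Proof.
move=> hu /NoDup_uniq hl hm; case: hL => -[_ [_ [_ [_ [_ [_ h]]]]]] _; apply: h => // f.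
by split => [/In_mem|fu]; [rewrite hm => /eqP | apply/In_mem; rewrite hm; apply/eqP].
Qed.

Lemma ve0 u f : s f != u -> v u ** e f = 0.
Proof. by move=> h; rewrite -vse namulA vw ?namul0l // eq_sym. Qed.
Lemma vs0 u f : r f != u -> v u ** es f = 0.
Proof. by move=> h; rewrite -vre namulA vw ?namul0l // eq_sym. Qed.
Lemma sv0 u f : s f != u -> es f ** v u = 0.
Proof. by move=> h; rewrite -esv -namulA vw ?namul0r. Qed.

(** For [p] = f1 ... fn these are the real path f1 ... fn and, in [gpath], the ghost path fn^* ...
    f1^*; the argument [u] gives the value at the empty path. *)
Fixpoint rpath u p : A := if p is f :: q then e f ** rpath (r f) q else v u.
Fixpoint gpath u p : A := if p is f :: q then gpath (r f) q ** es f else v u.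

Lemma rpath_l u p : walk u p -> v u ** rpath u p = rpath u p.
Proof. by case: p => [|f p] /=; rewrite ?vv // => /andP[/eqP <- _]; rewrite namulA vse. Qed.
Lemma gpath_r u p : walk u p -> gpath u p ** v u = gpath u p.
Proof. by case: p => [|f p] /=; rewrite ?vv // => /andP[/eqP <- _]; rewrite -namulA esv. Qed.
Lemma rpath_l0 u w p : walk u p -> u != w -> v w ** rpath u p = 0.
Proof. by move=> h uw; rewrite -rpath_l // namulA vw ?namul0l // eq_sym. Qed.
Lemma gpath_r0 u w p : walk u p -> u != w -> gpath u p ** v w = 0.
Proof. by move=> h uw; rewrite -gpath_r // -namulA vw ?namul0r. Qed.
Lemma rpath_r u p : rpath u p ** v (endpt u p) = rpath u p.
Proof. by elim: p u => [|f p IH] u /=; rewrite ?vv // -namulA [in X in e f ** X]/endpt /= IH. Qed.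
Lemma rpath_cat u p q : walk (endpt u p) q -> rpath u p ** rpath (endpt u p) q = rpath u (p ++ q).
Proof.
elim: p u => [|f p IH] u /= h; first by rewrite rpath_l.
by rewrite -namulA -IH.
Qed.
Lemma gpath_cat u p q : walk (endpt u p) q -> gpath (endpt u p) q ** gpath u p = gpath u (p ++ q).
Proof.
elim: p u => [|f p IH] u /= h; first by rewrite gpath_r.
by rewrite namulA -IH.
Qed.
Lemma gpath_rpath_cat u p q : walk u (p ++ q) -> gpath u p ** rpath u (p ++ q) = rpath (endpt u p) q.
Proof.
elim: p u => [|f p IH] u /=; first by move/rpath_l.
case/andP => _ h; rewrite -namulA (namulA (es f)) ese rpath_l //.
exact: IH.
Qed.
Lemma gpath_rpath u p : walk u p -> gpath u p ** rpath u p = v (endpt u p).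
Proof. by move=> h; have := @gpath_rpath_cat u p [::]; rewrite cats0 => ->. Qed.
Lemma gpath_pe0 u p q : walk u p -> walk u q -> (size p <= size q)%N -> ~~ prefix p q ->
  gpath u p ** rpath u q = 0.
Proof.
elim: p u q => [|f p IH] u [|g q] //= /andP[_ hp] /andP[_ hq] sz.
have [fg|fg] := eqVneq f g => /= npq; rewrite -namulA (namulA (es f)).
  by subst g; rewrite ese rpath_l // IH.
by rewrite ese0 // namul0l namul0r.
Qed.

(** [P] cuts out a subalgebra that contains the generators. The universal property maps [A] to it,
    and this map followed by the inclusion is the identity by uniqueness. *)
Lemma subalg_ind (P : A -> Prop) : P 0 ->
  (forall k x y, P x -> P y -> P (k *: x + y)) ->
  (forall x y, P x -> P y -> P (x ** y)) ->
  (forall u, P (v u)) -> (forall f, P (e f)) -> (forall f, P (es f)) ->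
  forall x, P x.
Proof.
move=> P0 PD PM Pv Pe Ps x.
have MA x1 x2 x3 : P x1 -> P x2 -> P x3 -> x1 ** (x2 ** x3) = x1 ** x2 ** x3.
  by move=> _ _ _; apply: namulA.
have MDl k x1 x2 x3 : P x1 -> P x2 -> P x3 ->
    (k *: x1 + x2) ** x3 = k *: (x1 ** x3) + x2 ** x3.
  by move=> _ _ _; rewrite namulDl namulZl.
have MDr k x1 x2 x3 : P x1 -> P x2 -> P x3 ->
    x1 ** (k *: x2 + x3) = k *: (x1 ** x2) + x1 ** x3.
  by move=> _ _ _; rewrite namulDr namulZr.
pose B := sub_nalg P0 PD PM MA MDl MDr.
pose inj := sub_in P0 PD PM MA MDl MDr.
have hB : lp_rel r s (fun u => inj (v u) (Pv u)) (fun f => inj (e f) (Pe f))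
    (fun f => inj (es f) (Ps f)).
  split; first by move=> u; apply/val_inj/vv.
  split; first by move=> u w /eqP uw; apply/val_inj; rewrite /= vw // raddf0.
  split; first by move=> f; split; apply/val_inj; [apply: vse | apply: evr].
  split; first by move=> f; split; apply/val_inj; [apply: vre | apply: esv].
  split; first by move=> f; apply/val_inj/ese.
  split; first by move=> f g /eqP fg; apply/val_inj; rewrite /= ese0 // raddf0.
  move=> u l hu hl hm; apply/val_inj.
  apply: etrans (esym (sub_val_sum P0 PD _ _)); apply: CK2 => //.
    exact/NoDup_uniq.
  by move=> f; apply/idP/eqP => [/In_mem/hm|/hm/In_mem].
have [[phi [[phiD phiM] [hv [he hs]]]] _] := (proj2 hL) _ _ _ _ hB.
have [_ uni] := (proj2 hL) _ _ _ _ (proj1 hL).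
have := uni (fun x => val (phi x)) id.
move=> /(_ _ _ _ _ _ x) <- //; first exact: sub_valPP.
- by split => [a x1 x2|x1 x2]; rewrite ?phiD ?phiM.
- by move=> u; rewrite hv.
- by move=> f; rewrite he.
- by move=> f; rewrite hs.
Qed.

Definition real_span x := exists l : seq (K * (E0 * seq E1)),
  (forall t, t \in l -> walk t.2.1 t.2.2) /\ x = \sum_(t <- l) t.1 *: rpath t.2.1 t.2.2.

(* [x] is a combination of monomials with ghost part of length at most [n]. *)
Fixpoint ghost_le n x : Prop :=
  if n is n'.+1 then
    exists a (l : seq (E1 * A)), real_span a /\ (forall t, t \in l -> ghost_le n' t.2) /\
      x = a + \sum_(t <- l) t.2 ** es t.1
  else real_span x.

Lemma real_span0 : real_span 0. Proof. by exists [::]; rewrite big_nil. Qed.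
Lemma real_span_add x y : real_span x -> real_span y -> real_span (x + y).
Proof.
move=> [l [hl ->]] [l' [hl' ->]]; exists (l ++ l'); rewrite big_cat; split => // t.
by rewrite mem_cat => /orP[/hl|/hl'].
Qed.
Lemma real_span_scale k x : real_span x -> real_span (k *: x).
Proof.
move=> [l [hl ->]]; exists [seq (k * t.1, t.2) | t <- l]; rewrite big_map scaler_sumr.
split; last by apply: eq_bigr => t _; rewrite scalerA.
by move=> t /mapP[t' /hl h ->].
Qed.
Lemma real_span_sum (T : eqType) (l : seq T) (F : T -> A) :
  (forall t, t \in l -> real_span (F t)) -> real_span (\sum_(t <- l) F t).
Proof.
elim: l => [|t l IH] h; first by rewrite big_nil; apply: real_span0.
rewrite big_cons; apply: real_span_add; first by apply: h; rewrite mem_head.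
by apply: IH => t' h'; apply: h; rewrite in_cons h' orbT.
Qed.
Lemma real_span_rpath u p : walk u p -> real_span (rpath u p).
Proof.
move=> h; exists [:: (1, (u, p))]; rewrite big_seq1 scale1r; split => // t.
by rewrite inE => /eqP ->.
Qed.
Lemma real_span_v x u : real_span x -> real_span (x ** v u).
Proof.
move=> [l [hl ->]]; rewrite namul_suml; apply: real_span_sum => t /hl ht.
rewrite namulZl; apply: real_span_scale.
have [<-|tu] := eqVneq (endpt t.2.1 t.2.2) u; first by rewrite rpath_r; apply: real_span_rpath.
by rewrite -rpath_r -namulA vw // namul0r; apply: real_span0.
Qed.
Lemma real_span_e x f : real_span x -> real_span (x ** e f).
Proof.
move=> [l [hl ->]]; rewrite namul_suml; apply: real_span_sum => t /hl ht.
rewrite namulZl; apply: real_span_scale.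
have [tu|tu] := eqVneq (s f) (endpt t.2.1 t.2.2).
  rewrite -(evr f) -[e f ** _]/(rpath (endpt t.2.1 t.2.2) [:: f]) rpath_cat /= ?tu ?eqxx //.
  by apply: real_span_rpath; rewrite walk_cat ht /= tu eqxx.
by rewrite -rpath_r -namulA ve0 // namul0r; apply: real_span0.
Qed.

Lemma ghost_le_real_span n x : real_span x -> ghost_le n x.
Proof. by case: n => //= n h; exists x, [::]; rewrite big_nil addr0. Qed.
Lemma ghost_le_step n x f : ghost_le n x -> ghost_le n.+1 (x ** es f).
Proof.
move=> h; exists 0, [:: (f, x)]; rewrite big_seq1 add0r; split; first exact: real_span0.
by split => // t; rewrite inE => /eqP ->.
Qed.
Lemma ghost_leS n x : ghost_le n x -> ghost_le n.+1 x.
Proof.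
elim: n x => [|n IH] x; first exact: ghost_le_real_span.
by move=> [p [l [hp [hl ->]]]]; exists p, l; split => //; split => // t /hl /IH.
Qed.
Lemma ghost_le_le n m x : (n <= m)%N -> ghost_le n x -> ghost_le m x.
Proof. by move=> /subnK <- h; elim: (m - n)%N => // k IH; apply: ghost_leS. Qed.
Lemma ghost_le_add n x y : ghost_le n x -> ghost_le n y -> ghost_le n (x + y).
Proof.
case: n => [|n]; first exact: real_span_add.
move=> [p [l [hp [hl ->]]]] [p' [l' [hp' [hl' ->]]]].
exists (p + p'), (l ++ l'); split; first exact: real_span_add.
split; first by move=> t; rewrite mem_cat => /orP[/hl|/hl'].
by rewrite big_cat addrACA.
Qed.
Lemma ghost_le_scale n k x : ghost_le n x -> ghost_le n (k *: x).
Proof.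
elim: n x => [|n IH] x; first exact: real_span_scale.
move=> [p [l [hp [hl ->]]]].
exists (k *: p), [seq (t.1, k *: t.2) | t <- l]; split; first exact: real_span_scale.
split; first by move=> t /mapP[t' /hl h ->]; apply: IH.
rewrite scalerDr scaler_sumr big_map; congr (_ + _).
by apply: eq_bigr => t _; rewrite namulZl.
Qed.
Lemma ghost_le_sum n (T : eqType) (l : seq T) (F : T -> A) :
  (forall t, t \in l -> ghost_le n (F t)) -> ghost_le n (\sum_(t <- l) F t).
Proof.
elim: l => [|t l IH] h; first by rewrite big_nil; apply/ghost_le_real_span/real_span0.
rewrite big_cons; apply: ghost_le_add; first by apply: h; rewrite mem_head.
by apply: IH => t' h'; apply: h; rewrite in_cons h' orbT.
Qed.
Lemma ghost_le_v n x u : ghost_le n x -> ghost_le n (x ** v u).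
Proof.
case: n => [|n]; first exact: real_span_v.
move=> [p [l [hp [hl ->]]]]; rewrite namulDl namul_suml.
apply: ghost_le_add; first exact/ghost_le_real_span/real_span_v.
apply: ghost_le_sum => t /hl ht; rewrite -namulA.
have [<-|tu] := eqVneq (s t.1) u; first by rewrite esv; apply: ghost_le_step.
by rewrite sv0 // namul0r; apply/ghost_le_real_span/real_span0.
Qed.
Lemma ghost_le_e n x f : ghost_le n x -> ghost_le n (x ** e f).
Proof.
case: n => [|n]; first exact: real_span_e.
move=> [p [l [hp [hl ->]]]]; rewrite namulDl namul_suml.
apply: ghost_le_add; first exact/ghost_le_real_span/real_span_e.
apply: ghost_le_sum => t /hl ht; rewrite -namulA.
have [<-|tu] := eqVneq t.1 f; first by rewrite ese; apply/ghost_leS/ghost_le_v.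
by rewrite ese0 // namul0r; apply/ghost_le_real_span/real_span0.
Qed.

Lemma ghost_le_all x : exists n, ghost_le n x.
Proof.
(* The [y] for which right multiplication keeps the ghost degree finite form a subalgebra that
   contains the generators. *)
have key : forall y x, (exists n, ghost_le n x) -> exists n, ghost_le n (x ** y).
  apply: subalg_ind.
  - by move=> y _; exists 0%N; rewrite namul0r; apply: real_span0.
  - move=> k y z hy hz x' hx'; have [n hn] := hy _ hx'; have [m hm] := hz _ hx'.
    exists (maxn n m); rewrite namulDr namulZr; apply: ghost_le_add.
      by apply/ghost_le_scale/(ghost_le_le _ hn)/leq_maxl.
    by apply/(ghost_le_le _ hm)/leq_maxr.
  - by move=> y z hy hz x' /hy /hz; rewrite namulA.
  - by move=> u x' [n hn]; exists n; apply: ghost_le_v.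
  - by move=> f x' [n hn]; exists n; apply: ghost_le_e.
  - by move=> f x' [n hn]; exists n.+1; apply: ghost_le_step.
move: x; apply: subalg_ind.
- by exists 0%N; apply: real_span0.
- move=> k y z [n hn] [m hm]; exists (maxn n m); apply: ghost_le_add.
    by apply/ghost_le_scale/(ghost_le_le _ hn)/leq_maxl.
  by apply/(ghost_le_le _ hm)/leq_maxr.
- by move=> x y hx _; apply: key.
- by move=> u; exists 0%N; apply: (@real_span_rpath u [::]).
- by move=> f; exists 0%N; rewrite -vse; apply/real_span_e/(@real_span_rpath _ [::]).
- by move=> f; rewrite -vre; apply: key; exists 0%N; apply: (@real_span_rpath _ [::]).
Qed.

Lemma mono_ind (P : A -> Prop) : P 0 -> (forall x y, P x -> P y -> P (x + y)) ->
  (forall k u p w q, walk u p -> walk w q -> endpt u p = endpt w q -> P (k *: (rpath u p ** gpath w q))) ->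
  forall x, P x.
Proof.
pose cl (Q : A -> Prop) := [/\ Q 0, (forall x y, Q x -> Q y -> Q (x + y)) &
  (forall k u p w q, walk u p -> walk w q -> endpt u p = endpt w q -> Q (k *: (rpath u p ** gpath w q)))].
move=> P0 PD Pm.
(* The predicate is generalized because the induction step for a term y f^* needs the claim for y
   with the predicate that sends z to Q (z f^* ). *)
suff key : forall n x, ghost_le n x -> forall Q, cl Q -> Q x.
  by move=> x; have [n /key] := ghost_le_all x; apply.
elim=> [|n IH] x /=.
  move=> [l [hl ->]] Q [Q0 QD Qm].
  elim: l hl => [|t l IH] hl; first by rewrite big_nil.
  rewrite big_cons; apply: QD; last by apply: IH => t' h; apply: hl; rewrite in_cons h orbT.
  by rewrite -rpath_r; apply: (Qm _ _ _ _ [::]) => //; apply: hl; rewrite mem_head.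
move=> [p [l [hp [hl ->]]]] Q hQ; have [Q0 QD Qm] := hQ.
apply: (QD _ _).
  have hp0 : ghost_le n p by exact: ghost_le_real_span.
  exact: IH.
elim: l hl => [|t l IHl] hl; first by rewrite big_nil.
rewrite big_cons; apply: (QD _ _ _ _); last by apply: IHl => t' h; apply: hl; rewrite in_cons h orbT.
apply: (IH _ (hl _ (mem_head _ _)) (fun x => Q (x ** es t.1))); split.
- by rewrite namul0l.
- by move=> x1 x2 h1 h2; rewrite namulDl; exact: QD.
- move=> k u q1 w q2 h1 h2 h12; rewrite namulZl -namulA.
  have [wE|wn] := eqVneq (r t.1) w; last first.
    by rewrite -gpath_r // -namulA vs0 // !namul0r scaler0.
  subst w; apply: (Qm k u q1 (s t.1) (t.1 :: q2)) => //=.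
  by rewrite eqxx.
Qed.

Lemma local_unit x : exists U, U ** x = x /\ x ** U = x /\
  exists2 l : seq E0, uniq l & U = \sum_(w <- l) v w.
Proof.
(* Asking for all larger sets of vertices lets the units of two summands be merged. *)
suff [l hl] : exists l : seq E0, forall l', uniq l' -> {subset l <= l'} ->
    (\sum_(w <- l') v w) ** x = x /\ x ** (\sum_(w <- l') v w) = x.
  exists (\sum_(w <- undup l) v w).
  have [|h1 h2] := hl (undup l) (undup_uniq l); first by move=> w; rewrite mem_undup.
  by split => //; split => //; exists (undup l); rewrite ?undup_uniq.
have hU u l' : uniq l' -> u \in l' -> v u ** (\sum_(w <- l') v w) = v u.
  move=> ul' ul; rewrite (bigD1_seq u) //= namulDr vv namul_sumr big1 ?addr0 //.
  by move=> w wu; rewrite vw // eq_sym.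
have hU' u l' : uniq l' -> u \in l' -> (\sum_(w <- l') v w) ** v u = v u.
  move=> ul' ul; rewrite (bigD1_seq u) //= namulDl vv namul_suml big1 ?addr0 //.
  by move=> w wu; rewrite vw.
move: x; apply: mono_ind.
- by exists [::] => l' _ _; rewrite namul0r namul0l.
- move=> x y [l1 h1] [l2 h2]; exists (l1 ++ l2) => l' ul' sl'.
  have [|h1a h1b] := h1 l' ul'; first by move=> w wl; apply: sl'; rewrite mem_cat wl.
  have [|h2a h2b] := h2 l' ul'; first by move=> w wl; apply: sl'; rewrite mem_cat wl orbT.
  by rewrite namulDr namulDl h1a h1b h2a h2b.
- move=> k u p w q hp hq hpq; exists [:: u; w] => l' ul' sl'.
  have Uu : (\sum_(w <- l') v w) ** rpath u p = rpath u p.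
    by rewrite -(rpath_l hp) namulA hU' // sl' // mem_head.
  have Uw : gpath w q ** (\sum_(w <- l') v w) = gpath w q.
    by rewrite -(gpath_r hq) -namulA hU // sl' // !inE eqxx orbT.
  by rewrite namulZr namulZl namulA Uu -namulA Uw.
Qed.

(** [is_ideal] describes a ring ideal; closure under scalars comes from k x = (k U) x with a local
    unit U. *)
Lemma idealZ (I : A -> Prop) k x : is_ideal I -> I x -> I (k *: x).
Proof.
move=> hI Ix; have [U [<- _]] := local_unit x.
by rewrite -namulZl; apply: idealMl.
Qed.
Lemma ideal_vr (I : A -> Prop) x : is_ideal I -> (forall w, I (x ** v w)) -> I x.
Proof.
move=> hI h; have [U [_ [<- [l _ ->]]]] := local_unit x.
by rewrite namul_sumr; apply: ideal_sum => // w _; apply: h.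
Qed.
Lemma ideal_vl (I : A -> Prop) x : is_ideal I -> (forall w, I (v w ** x)) -> I x.
Proof.
move=> hI h; have [U [<- [_ [l _ ->]]]] := local_unit x.
by rewrite namul_suml; apply: ideal_sum => // w _; apply: h.
Qed.

End LPA.

(** * Periodic paths and cycles *)

Section Combinatorics.
Variables (E0 E1 : eqType) (r s : E1 -> E0).
Implicit Types (u w : E0) (f g : E1) (p q c : seq E1) (H : E0 -> Prop).
Notation walk := (walk r s).
Notation endpt := (endpt r).

Lemma chain_walk f p : chain r s (f :: p) <-> walk (s f) (f :: p).
Proof.
elim: p f => [|g p IH] f /=; first by rewrite eqxx.
rewrite eqxx /=; split; first by case=> h /IH; rewrite /= h eqxx.
by case/andP=> /eqP h1 h2; split => //; apply/IH; rewrite /= eqxx.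
Qed.

Definition edge_closed H := forall f, H (s f) -> H (r f).

Lemma edge_closed_endpt H u p : edge_closed H -> walk u p -> H u -> H (endpt u p).
Proof.
move=> hH; elim: p u => [|f p IH] u //= /andP[/eqP <- hp] /hH; exact: IH.
Qed.

Lemma hereditaryE H : hereditary r s H <-> edge_closed H.
Proof.
split=> hH; first by move=> f hf; apply: (hH _ _ [:: f] hf).
move=> u w [|f p] //= hu [/chain_walk hp [sf rf]].
have -> : w = endpt (s f) (f :: p) by rewrite -rf /endpt /= last_map.
by apply: edge_closed_endpt => //; rewrite sf.
Qed.

Definition cyc w c := [&& c != [::], walk w c, endpt w c == w & uniq (map s c)].

Lemma is_cycleE c : is_cycle r s c <-> exists w, cyc w c.
Proof.
case: c => [|f c]; first by split=> [[]//|[w]]; rewrite /cyc eqxx.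
rewrite /is_cycle /cyc; split.
  case=> -[/chain_walk h1 h2] /NoDup_uniq h3; exists (s f).
  by rewrite h1 h3 /endpt /= last_map h2 eqxx.
case=> w /= /and3P[/andP[/eqP <- h1] /eqP h2 h3]; split; last exact/NoDup_uniq.
split; first by apply/chain_walk; rewrite /= eqxx.
by rewrite -last_map.
Qed.

(* [qual_cycle H c] with an explicit base point [w]. *)
Definition qual_at H w c := [/\ cyc w c, (forall f, f \in c -> ~ H (s f)) &
  forall f g, f \in c -> s g = s f -> g \notin c -> H (r g)].

Lemma endpt_take d w p i : walk w p -> (i < size p)%N -> endpt w (take i p) = s (nth d p i).
Proof.
elim: p w i => [|f p IH] w [|i] //= /andP[/eqP sf hp]; first by rewrite sf.
by rewrite ltnS => hi; apply: IH.
Qed.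

Lemma walk_takedrop w p i : walk w p -> walk w (take i p) /\ walk (endpt w (take i p)) (drop i p).
Proof. by rewrite -{1}(cat_take_drop i p) walk_cat => /andP[]. Qed.

Lemma cyc_size w c : cyc w c -> (0 < size c)%N.
Proof. by case/and4P; case: c. Qed.

Lemma cyc_head d w c : cyc w c -> s (nth d c 0) = w.
Proof. by case/and4P; case: c => //= f c _ /andP[/eqP ->]. Qed.

Lemma cyc_next d w c j : cyc w c -> (j < size c)%N ->
  r (nth d c j) = s (nth d c (j.+1 %% size c)).
Proof.
move=> hc hj; have /and4P[_ hw /eqP hr _] := hc.
have : endpt w (take j.+1 c) = r (nth d c j) by rewrite (take_nth d hj) endpt_rcons.
case: (ltnP j.+1 (size c)) => hj1.
  by rewrite modn_small // (endpt_take d hw hj1) => ->.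
have -> : j.+1 = size c by apply/eqP; rewrite eqn_leq hj hj1.
by rewrite modnn take_size (cyc_head d hc) hr => ->.
Qed.

Lemma cyc_inj w c f g : cyc w c -> f \in c -> g \in c -> s f = s g -> f = g.
Proof.
case/and4P => _ _ _ uc fc gc sfg.
rewrite -(nth_index f fc) -(nth_index f gc); congr nth; apply/eqP.
rewrite -(nth_uniq (s f) _ _ uc) ?size_map ?index_mem //.
by rewrite !(nth_map f) ?index_mem // !nth_index // sfg.
Qed.

Lemma cyc_succ w c f : cyc w c -> f \in c -> exists2 g, g \in c & s g = r f.
Proof.
move=> hc fc; exists (nth f c ((index f c).+1 %% size c)).
  by rewrite mem_nth // ltn_mod (cyc_size hc).
by rewrite -(cyc_next f hc) ?index_mem // nth_index.
Qed.

Lemma qual_cycleE H c : edge_closed H -> qual_cycle r s H c <-> exists w, qual_at H w c.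
Proof.
move=> hH; split.
  case=> /is_cycleE [w hc] [h1 h2]; exists w; split => // [f /In_mem /h1 []//|].
  move=> f g fc sg gc; apply: h2; split; first by move/In_mem; apply/negP.
  by exists f; split => //; apply/In_mem.
case=> w [hc h1 h2]; split; first by apply/is_cycleE; exists w.
split=> [f /In_mem fc|g [gc [f [/In_mem fc sg]]]].
  split; first exact: h1.
  by have [g /h1 hg <-] := cyc_succ hc fc.
by apply: h2 fc sg _; apply/negP => /In_mem.
Qed.

(** The first [L] edges of the infinite path c c c ...; [d] is only a default for [nth]. *)
Definition per d c L := mkseq (fun j => nth d c (j %% size c)) L.

Lemma size_per d c L : size (per d c L) = L. Proof. exact: size_mkseq. Qed.
Lemma nth_per d c L j : (j < L)%N -> nth d (per d c L) j = nth d c (j %% size c).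
Proof. exact: nth_mkseq. Qed.
Lemma per_cat d c L : per d c (size c + L) = c ++ per d c L.
Proof.
apply: (@eq_from_nth _ d) => [|j]; rewrite ?size_cat !size_per // => hj.
rewrite nth_per // nth_cat; case: (ltnP j (size c)) => hjc; first by rewrite modn_small.
rewrite nth_per; last by rewrite ltn_subLR.
by rewrite -{1}(subnK hjc) modnDr.
Qed.
Lemma per_catM d c k L : per d c (k * size c + L) = per d c (k * size c) ++ per d c L.
Proof.
elim: k => [|k IH]; first by rewrite mul0n.
by rewrite mulSn -addnA per_cat IH per_cat catA.
Qed.
Lemma per_mem d c L f : (0 < size c)%N -> f \in per d c L -> f \in c.
Proof.
move=> hc /(nthP d) [j]; rewrite size_per => hj <-.
by rewrite nth_per // mem_nth // ltn_mod.
Qed.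
Lemma perS d c L : per d c L.+1 = rcons (per d c L) (nth d c (L %% size c)).
Proof.
apply: (@eq_from_nth _ d) => [|j]; rewrite ?size_rcons !size_per // => hj.
rewrite nth_per // nth_rcons size_per; move: hj; rewrite ltnS leq_eqVlt.
by case/orP=> [/eqP ->|h]; rewrite ?ltnn ?eqxx // h nth_per.
Qed.

Lemma cyc_per d w c L : cyc w c ->
  walk w (per d c L) /\ endpt w (per d c L) = s (nth d c (L %% size c)).
Proof.
move=> hc; elim: L => [|L [IH1 IH2]]; first by rewrite mod0n (cyc_head d hc).
rewrite perS endpt_rcons -cats1 walk_cat IH1 /= IH2 eqxx; split => //.
rewrite (cyc_next d hc) ?ltn_mod ?(cyc_size hc) // -addn1 modnDml addn1.
by [].
Qed.

(** After [L] steps along c the path is at the vertex number [L %% size c], and the vertices of c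
    are distinct. *)
Lemma per_dvd d w c L : cyc w c -> endpt w (per d c L) = w -> (size c %| L)%N.
Proof.
move=> hc; have [_ ->] := cyc_per d L hc; rewrite -{1}(cyc_head d hc) => h.
have hs := cyc_size hc.
have /cyc_inj := hc; move/(_ _ _ _ _ h).
have hm : (L %% size c < size c)%N by rewrite ltn_mod.
rewrite !mem_nth // => /(_ erefl erefl) /eqP.
have /and4P[_ _ _ /map_uniq uc] := hc.
by rewrite nth_uniq.
Qed.

(** Only an exit leads off c; it ends in [H], and no path leaves [H] again. *)
Lemma qual_at_follow d H w c p : edge_closed H -> qual_at H w c -> walk w p -> ~ H (endpt w p) ->
  p = per d c (size p).
Proof.
move=> hH [hc h1 h2]; elim/last_ind: p => [|p f IH] //.
rewrite endpt_rcons size_rcons perS -cats1 walk_cat /= andbT => /andP[hp /eqP sf] hr.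
have hrl : ~ H (endpt w p) by rewrite -sf => /hH.
have ep := IH hp hrl; rewrite -cats1 -ep; congr (_ ++ [:: _]).
have [_] := cyc_per d (size p) hc; rewrite -ep -sf => sfg.
set g := nth d c _ in sfg *.
have gc : g \in c by rewrite mem_nth // ltn_mod (cyc_size hc).
apply: (cyc_inj hc) => //; case: (boolP (f \in c)) => // fc.
by case: hr; apply: h2 gc _ fc.
Qed.

(** The prefix relation makes [p] begin like [q] and repeat with period [size q]. *)
Lemma prefix_per d p q : (0 < size q)%N -> prefix p (q ++ p) -> p = per d q (size p).
Proof.
move=> hq /prefixP [t ht]; apply: (@eq_from_nth _ d); rewrite ?size_per // => j.
elim/ltn_ind: j => j IH hj; rewrite nth_per //.
have := congr1 (fun l => nth d l j) ht; rewrite nth_cat (nth_cat _ p) hj => <-.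
case: ltnP => hjq; first by rewrite modn_small.
rewrite IH; [|by rewrite ltn_subrL hq (leq_trans hq)|by rewrite (leq_ltn_trans (leq_subr _ _))].
rewrite nth_per ?(leq_ltn_trans (leq_subr _ _)) //.
by rewrite -{2}(subnK hjq) modnDr.
Qed.

Lemma closed_per d w c k : walk w c -> endpt w c = w ->
  walk w (per d c (k * size c)) /\ endpt w (per d c (k * size c)) = w.
Proof.
move=> hc hr; elim: k => [|k [IH1 IH2]] //.
by rewrite mulSn per_cat walk_cat endpt_cat hr hc IH1 IH2.
Qed.

Section Periodic.
Variables (H : E0 -> Prop) (w : E0) (G : seq (seq E1)) (d : E1).
Hypotheses (hH : edge_closed H) (hw : ~ H w).
Hypothesis hG : forall q, q \in G -> [/\ q != [::], walk w q & endpt w q = w].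
Hypothesis hp : forall p, walk w p -> ~ H (endpt w p) -> exists2 q, q \in G & prefix p (q ++ p).

(* Prolonging [p] on the left by a power of [c] whose length is a multiple of all
   the lengths in [G] makes the period of [c ^ N ++ p] compatible with [c]. *)
Lemma periodic c p : c != [::] -> walk w c -> endpt w c = w ->
  walk w p -> ~ H (endpt w p) -> p = per d c (size p).
Proof.
move=> c0 hc hr hwp hrp.
have sc : (0 < size c)%N by case: (c) c0.
pose N := (\prod_(q <- G) size q)%N.
have N0 : (0 < N)%N.
  rewrite /N big_seq; elim/big_ind: _ => // [a b|q /hG []]; first by rewrite muln_gt0 => -> ->.
  by case: q.
have hN q : q \in G -> (size q %| N)%N.
  by move=> qG; rewrite /N (big_rem q) //= dvdn_mulr.
have [h1 h2] := closed_per d N hc hr.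
set M := (N * size c)%N in h1 h2.
have [||q qG] := hp (p := per d c M ++ p).
- by rewrite walk_cat h1 h2.
- by rewrite endpt_cat h2.
have sq : (0 < size q)%N by have [] := hG qG; case: (q).
move=> /(prefix_per d sq) hq.
have M0 : (0 < M)%N by rewrite muln_gt0 N0.
have qM : (size q %| M)%N by rewrite dvdn_mulr // hN.
(* Both [size q] and [size c] divide [M], so entry j of [p] and entry [j %% M] of the power of c are
   the same entry of [q]. *)
apply: (@eq_from_nth _ d) => [|j hj]; rewrite ?size_per // nth_per //.
have k1 : nth d p j = nth d q (j %% size q).
  have := congr1 (fun l => nth d l (M + j)) hq.
  rewrite nth_cat size_per ltnNge leq_addr /= addKn => ->.
  rewrite nth_per; last by rewrite size_cat size_per ltn_add2l.
  by rewrite -modnDm (eqP qM) add0n modn_mod.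
have tM : (j %% M < M)%N by rewrite ltn_mod.
have k2 := congr1 (fun l => nth d l (j %% M)) hq.
rewrite nth_cat size_per tM nth_per // nth_per in k2; last first.
  by rewrite size_cat size_per ltn_addr.
by rewrite k1 -(modn_dvdm j qM) -k2 modn_dvdm // dvdn_mull.
Qed.

(** The cycle is a shortest closed path c at [w]. By [periodic], every path from [w] that ends
    outside [H] follows c. For a step off c this shows that c is qualified; for the members of [G]
    it shows that they are powers of c. *)
Lemma periodic_cycle : exists2 c, qual_at H w c &
  forall q, q \in G -> exists k, q = per d c (k * size c).
Proof.
pose P n := `[< exists q, [/\ q != [::], walk w q, endpt w q = w & size q = n] >].
have exP : exists n, P n.
  (* Applied to the empty path, [hp] shows that [G] is not empty. *)
  have [|q qG _] := hp (p := [::]) isT; first by [].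
  by exists (size q); apply/asboolP; exists q; have [] := hG qG.
case: (ex_minnP exP) => n /asboolP [c [c0 hc hr sn]] hmin.
(* If positions i < j had the same source, cutting out the segment between them would leave a
   shorter closed path, nonempty because j is a position of c. *)
have ucs : uniq (map s c).
  apply/negPn/negP => /(uniqPn (s d)) [i [j [ij]]]; rewrite size_map => jc.
  have ic := ltn_trans ij jc; rewrite !(nth_map d) // => sij.
  have [k1 k2] := walk_takedrop i hc; have [k3 k4] := walk_takedrop j hc.
  have eij : endpt w (take i c) = endpt w (take j c) by rewrite !(endpt_take d) // sij.
  have lt_n : (i + (n - j) < n)%N.
    by rewrite -sn -{2}(subnKC (ltnW jc)) ltn_add2r.
  suff /hmin : P (i + (n - j))%N by rewrite leqNgt lt_n.
  apply/asboolP; exists (take i c ++ drop j c); split.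
  - by rewrite -size_eq0 -lt0n size_cat size_drop addn_gt0 subn_gt0 jc orbT.
  - by rewrite walk_cat k1 eij k4.
  - by rewrite endpt_cat eij -endpt_cat cat_take_drop.
  - by rewrite size_cat size_drop size_takel ?sn // -sn ltnW.
have hcyc : cyc w c by rewrite /cyc c0 hc hr eqxx ucs.
have sc := cyc_size hcyc.
exists c; last first.
  move=> q qG; have [q0 hq rq] := hG qG.
  have eq := periodic c0 hc hr hq; rewrite rq in eq; have {}eq := eq hw.
  have : endpt w (per d c (size q)) = w by rewrite -eq.
  by move/(per_dvd hcyc)/dvdnP => [k hk]; exists k; rewrite -hk.
split => // [f fc|f g fc sg].
  move=> hf; case: hw; rewrite -hr.
  have hi : (index f c < size c)%N by rewrite index_mem.
  have [_ h4] := walk_takedrop (index f c) hc.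
  rewrite (endpt_take f) // nth_index // in h4.
  rewrite -(cat_take_drop (index f c) c) endpt_cat (endpt_take f) // nth_index //.
  exact: edge_closed_endpt.
(* An edge g off c that ends outside [H], appended to the part of c before its source, would be a
   path that has to follow c. *)
move=> gc; case: (EM (H (r g))) => // hg.
have hi : (index f c < size c)%N by rewrite index_mem.
have [h3 _] := walk_takedrop (index f c) hc.
have eqp := @periodic c (rcons (take (index f c) c) g) c0 hc hr.
have {eqp} : rcons (take (index f c) c) g = per d c (index f c).+1.
  rewrite eqp ?size_rcons ?size_takel ?(ltnW hi) //.
    by rewrite -cats1 walk_cat h3 /= (endpt_take f) // nth_index // sg eqxx.
  by rewrite endpt_rcons.
move=> eqg; case/negP: gc; apply: (@per_mem d c (index f c).+1) => //.
by rewrite -eqg mem_rcons mem_head.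
Qed.

End Periodic.
End Combinatorics.

(** * Generators of an ideal *)

Section Structure.
Variables (K : fieldType) (E0 E1 : eqType) (r s : E1 -> E0).
Variables (A : nalg K) (v : E0 -> A) (e es : E1 -> A).
Hypothesis hL : is_LPA r s v e es.
Implicit Types (u w : E0) (f g : E1) (p q c : seq E1) (x y z : A) (F : {poly K}).
Notation walk := (walk r s).
Notation endpt := (endpt r).
Notation rpath := (rpath r v e).
Notation real_span := (real_span r s v e).

Definition cpow w c i : A := iter i (namul (rpath w c)) (v w).
(* The element F(c), where c^0 is the base vertex [w]. *)
Definition ev w c F : A := \sum_(i < size F) F`_i *: cpow w c i.

Lemma ev_widen w c F n : (size F <= n)%N -> ev w c F = \sum_(i < n) F`_i *: cpow w c i.
Proof.
move=> h; rewrite /ev (big_ord_widen n (fun i => F`_i *: cpow w c i)) //.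
rewrite big_mkcond; apply: eq_bigr => i _; case: ltnP => // hi.
by rewrite nth_default // scale0r.
Qed.
Lemma ev_lin w c k F G : ev w c (k *: F + G) = k *: ev w c F + ev w c G.
Proof.
pose n := maxn (size (k *: F + G)) (maxn (size F) (size G)).
rewrite !(@ev_widen _ _ _ n) ?leq_max ?leqnn ?orbT // scaler_sumr -big_split /=.
by apply: eq_bigr => i _; rewrite coefD coefZ scalerDl scalerA.
Qed.
Lemma ev0 w c : ev w c 0 = 0.
Proof. by rewrite /ev size_poly0 big_ord0. Qed.
Lemma evD w c F G : ev w c (F + G) = ev w c F + ev w c G.
Proof. by rewrite -[F in LHS]scale1r ev_lin scale1r. Qed.
Lemma evZ w c k F : ev w c (k *: F) = k *: ev w c F.
Proof. by rewrite -[k *: F]addr0 ev_lin ev0 addr0. Qed.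
Lemma evB w c F G : ev w c (F - G) = ev w c F - ev w c G.
Proof. by rewrite evD -[- G]scaleN1r evZ scaleN1r. Qed.
Lemma ev_C w c k : ev w c k%:P = k *: v w.
Proof.
by rewrite (@ev_widen _ _ _ 1) ?size_polyC ?leq_b1 // big_ord1 coefC.
Qed.
Lemma evMX w c F : ev w c (F * 'X) = rpath w c ** ev w c F.
Proof.
rewrite (@ev_widen _ _ _ (size F).+1); last first.
  by apply: (leq_trans (size_polyMleq _ _)); rewrite size_polyX addn2.
rewrite big_ord_recl coefMX eqxx scale0r add0r namul_sumr.
by apply: eq_bigr => i _; rewrite coefMX /= namulZr.
Qed.

Section Closed.
Variables (w : E0) (c : seq E1).
Hypotheses (hc : walk w c) (rc : endpt w c = w).
Lemma v_rpath : v w ** rpath w c = rpath w c. Proof. exact: (rpath_l hL hc). Qed.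
Lemma v_cpow i : v w ** cpow w c i = cpow w c i.
Proof. by case: i => [|i] /=; rewrite ?(vv hL) // namulA v_rpath. Qed.
Lemma cpow_per d i : cpow w c i = rpath w (per d c (i * size c)).
Proof.
elim: i => [|i IH] //=; rewrite IH mulSn per_cat -{2}rc (rpath_cat hL) //.
by rewrite rc; case: (closed_per d i hc rc).
Qed.
Lemma ev_v F : v w ** ev w c F = ev w c F.
Proof.
by rewrite namul_sumr; apply: eq_bigr => i _; rewrite namulZr v_cpow.
Qed.
Lemma evXn i : ev w c 'X^i = cpow w c i.
Proof.
elim: i => [|i IH]; first by rewrite expr0 -polyC1 ev_C scale1r.
by rewrite exprSr evMX IH.
Qed.
Lemma evM F G : ev w c (F * G) = ev w c F ** ev w c G.
Proof.
elim/poly_ind: F => [|F k IH]; first by rewrite mul0r ev0 namul0l.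
rewrite mulrDl -mulrA (mulrC 'X) mulrA !evD !evMX mul_polyC evZ IH ev_C.
by rewrite namulDl namulZl ev_v namulA.
Qed.
Lemma evr_v F : ev w c F ** v w = ev w c F.
Proof. by rewrite -{2}(mulr1 F) evM -polyC1 ev_C scale1r. Qed.
End Closed.

Lemma ideal_edge_closed (I : A -> Prop) : is_ideal I ->
  edge_closed r s (fun u => I (v u)).
Proof.
move=> hI f If; rewrite -(ese hL) -(esv hL) -namulA.
by apply: (idealMl hI); apply: (idealMr hI).
Qed.

Lemma ideal_scaleP (I : A -> Prop) k x : is_ideal I -> k != 0 -> I (k *: x) -> I x.
Proof.
move=> hI k0 Ik; rewrite -(scale1r x) -(mulVf k0) -scalerA.
exact: (idealZ hL).
Qed.

Definition based w y := exists k (l : seq (K * seq E1)),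
  [/\ k != 0, (forall t, t \in l -> [/\ t.2 != [::], walk w t.2 & endpt w t.2 = w]) &
      y = k *: v w + \sum_(t <- l) t.1 *: rpath w t.2].

Lemma v_sum_rpath u (l : seq (K * seq E1)) : (forall t, t \in l -> walk u t.2) ->
  v u ** (\sum_(t <- l) t.1 *: rpath u t.2) = \sum_(t <- l) t.1 *: rpath u t.2.
Proof.
move=> hl; rewrite namul_sumr big_seq [RHS]big_seq; apply: eq_bigr => t /hl h.
by rewrite namulZr (rpath_l hL).
Qed.

Lemma based_const w u (l : seq (K * seq E1)) :
  (forall t, t \in l -> walk u t.2 /\ endpt u t.2 = w) ->
  \sum_(t <- l | t.2 == [::]) t.1 != 0 ->
  based w (\sum_(t <- l) t.1 *: rpath u t.2).
Proof.
move=> hl k0; have uw : u = w.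
  have : has (fun t => t.2 == [::]) l.
    apply: contraNT k0 => /hasPn h; rewrite big_seq_cond big1 // => t.
    by case/andP=> /h /negbTE ->.
  by case/hasP => t /hl [_ <-] /eqP ->.
subst u; exists (\sum_(t <- l | t.2 == [::]) t.1), [seq t <- l | t.2 != [::]]; split => //.
  by move=> t; rewrite mem_filter => /andP[t0 /hl []].
rewrite big_filter scaler_suml (bigID (fun t => t.2 == [::])) /=.
by congr (_ + _); apply: eq_bigr => t /eqP ->.
Qed.

(** Induction on the length of the paths. If the coefficient k of the empty path is nonzero, nothing
    has to be stripped. Otherwise x is the sum of f f^* x over the first edges f, so some f^* x lies
    outside [J], and its paths are shorter. *)
Lemma left_reduce (J : A -> Prop) w n u (l : seq (K * seq E1)) : is_ideal J ->
  (forall t, t \in l -> [/\ walk u t.2, endpt u t.2 = w & (size t.2 <= n)%N]) ->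
  ~ J (\sum_(t <- l) t.1 *: rpath u t.2) ->
  exists a, based w (a ** \sum_(t <- l) t.1 *: rpath u t.2) /\
    ~ J (a ** \sum_(t <- l) t.1 *: rpath u t.2).
Proof.
move=> hJ; elim: n u l => [|n IH] u l hl; set x := \sum_(t <- l) _ => nJ;
  pose k := \sum_(t <- l | t.2 == [::]) t.1;
  have ex : x = k *: v u + \sum_(t <- l | t.2 != [::]) t.1 *: rpath u t.2;
  try (rewrite /x (bigID (fun t => t.2 == [::])) /= /k scaler_suml; congr (_ + _);
    by apply: eq_bigr => t /eqP ->);
  have [k0|k0] := eqVneq k 0.
- case: nJ; rewrite ex k0 scale0r add0r big_seq_cond big1 => [|t /andP[/hl []]].
    exact: ideal0.
  by rewrite leqn0 size_eq0 => _ _ ->.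
- exists (v u); rewrite v_sum_rpath => [|t /hl [] //]; split => //.
  by apply: based_const => // t /hl [].
- pose hs := undup (pmap (fun t : K * seq E1 => ohead t.2) l).
  have ex' : x = \sum_(f <- hs) e f ** (es f ** x).
    under eq_bigr => f _ do rewrite namulA {1}ex k0 scale0r add0r namul_sumr.
    rewrite exchange_big /= {1}ex k0 scale0r add0r big_seq_cond [RHS]big_seq_cond.
    apply: eq_bigr => -[a q] /andP[/= tl]; case: q tl => //= f q tl _.
    have fh : f \in hs.
      rewrite mem_undup mem_pmap; apply/mapP; exists (a, f :: q) => //.
    rewrite (bigD1_seq f) ?undup_uniq //= namulZr -namulA (namulA (es f)) (ese hL).
    have [/= /andP[_ hq] _ _] := hl _ tl.
    rewrite (rpath_l hL hq) big1 ?addr0 // => g gf.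
    by rewrite namulZr -namulA (namulA (es g)) (ese0 hL) // namul0l namul0r scaler0.
  have [f nJf] : exists f, ~ J (es f ** x).
    apply: contrapT => h; apply: nJ; rewrite ex'; apply: ideal_sum => // f _.
    by apply: (idealMl hJ); apply: contrapT => hf; apply: h; exists f.
  pose l' := [seq (t.1, behead t.2) | t <- l & ohead t.2 == Some f].
  have efx : es f ** x = \sum_(t <- l') t.1 *: rpath (r f) t.2.
    rewrite /l' big_map big_filter ex k0 scale0r add0r namul_sumr.
    rewrite [RHS]big_mkcond [LHS]big_mkcond /= big_seq [RHS]big_seq.
    apply: eq_bigr => -[a [|g q]] //= /hl [/= /andP[_ hq] _ _].
    rewrite namulZr namulA; have [gf|gf] := eqVneq g f.
      by subst g; rewrite eqxx (ese hL) (rpath_l hL).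
    rewrite (ese0 hL) 1?eq_sym // namul0l scaler0.
    by case: eqP => // -[] h; rewrite h eqxx in gf.
  have [||a ha] := IH (r f) l'.
  + move=> t /mapP [[a [|g q]]]; rewrite mem_filter //= => /andP[/eqP [->] /hl].
    by move=> [/= /andP[_ h1] h2 h3] ->.
  + by rewrite -efx.
  + by exists (a ** es f); rewrite -namulA efx.
- exists (v u); rewrite v_sum_rpath => [|t /hl [] //]; split => //.
  by apply: based_const => // t /hl [].
Qed.

Lemma left_reduce_real_span (J : A -> Prop) w x : is_ideal J -> real_span x -> x ** v w = x -> ~ J x ->
  exists a, based w (a ** x) /\ ~ J (a ** x).
Proof.
move=> hJ [l [hl ex]] xw nJ.
have [u nJu] : exists u, ~ J (v u ** x).
  apply: contrapT => h; apply: nJ; apply: (ideal_vl hL hJ) => u.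
  by apply: contrapT => hu; apply: h; exists u.
pose l' := [seq (t.1, t.2.2) | t <- l & (t.2.1 == u) && (endpt u t.2.2 == w)].
have eu : v u ** x = \sum_(t <- l') t.1 *: rpath u t.2.
  rewrite big_map big_filter -xw ex namul_suml namul_sumr.
  rewrite [RHS]big_mkcond /= big_seq [RHS]big_seq; apply: eq_bigr => -[a [u' p]] /hl /= h.
  rewrite namulZl namulZr; have [eu|nu] := eqVneq u' u => /=; last first.
    by rewrite namulA (rpath_l0 hL) // namul0l scaler0.
  subst u'; rewrite namulA (rpath_l hL) //; case: eqP => [<-|/eqP nw].
    by rewrite (rpath_r hL).
  by rewrite -(rpath_r hL) -namulA (vw hL) // namul0r scaler0.
have [||a ha] := @left_reduce J w (\max_(t <- l') size t.2) u l' hJ.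
- move=> t tl'; split; last by rewrite (big_rem t) //= leq_maxl.
    by case/mapP: tl' => t'; rewrite mem_filter => /andP[/andP[/eqP <- _] /hl h] ->.
  by case/mapP: tl' => t'; rewrite mem_filter => /andP[/andP[/eqP eu' /eqP h] _] ->.
- by rewrite -eu.
- by exists (a ** v u); rewrite -namulA eu.
Qed.

End Structure.

(** * The elements v^H and the generation theorem for ideals *)

Section Ideals.
Variables (K : fieldType) (E0 E1 : eqType) (r s : E1 -> E0).
Variables (A : nalg K) (v : E0 -> A) (e es : E1 -> A).
Hypothesis hL : is_LPA r s v e es.
Implicit Types (u w : E0) (f g : E1) (p q c : seq E1) (x y z : A) (F : {poly K}).
Notation walk := (walk r s).
Notation endpt := (endpt r).
Notation rpath := (rpath r v e).
Notation gpath := (gpath r v es).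
Notation real_span := (real_span r s v e).
Notation ghost_le := (ghost_le r s v e es).
Notation qual_at := (qual_at r s).
Notation ev := (ev r v e).

(* This is [w^H] when [l] lists the edges from [w] that do not end in [H]. *)
Definition cut w (l : seq E1) : A := v w - \sum_(f <- l) e f ** es f.

Section Cut.
Variables (w : E0) (l : seq E1).
Hypotheses (ul : uniq l) (hl : forall f, f \in l -> s f = w).
Lemma cut_e f : f \in l -> cut w l ** e f = 0.
Proof.
move=> fl; rewrite namulBl -{1}(hl fl) (vse hL) namul_suml (bigD1_seq f) //=.
rewrite -namulA (ese hL) (evr hL) big1 ?addr0 ?subrr // => g gf.
by rewrite -namulA (ese0 hL) // namul0r.
Qed.
Lemma s_cut f : f \in l -> es f ** cut w l = 0.
Proof.
move=> fl; rewrite namulBr -{1}(hl fl) (esv hL) namul_sumr (bigD1_seq f) //=.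
rewrite namulA (ese hL) (vre hL) big1 ?addr0 ?subrr // => g gf.
by rewrite namulA (ese0 hL) 1?eq_sym // namul0l.
Qed.
Lemma s_cut0 f : s f != w -> es f ** cut w l = 0.
Proof.
move=> fw; rewrite namulBr (sv0 hL) // namul_sumr big_seq big1 ?subr0 // => g /hl gw.
by rewrite namulA (ese0 hL) ?namul0l //; apply: contraNneq fw => ->; rewrite gw.
Qed.
Lemma v_cut : v w ** cut w l = cut w l.
Proof.
rewrite namulBr (vv hL) namul_sumr; congr (_ - _).
by rewrite big_seq [RHS]big_seq; apply: eq_bigr => f /hl <-; rewrite namulA (vse hL).
Qed.
Lemma cut_v : cut w l ** v w = cut w l.
Proof.
rewrite namulBl (vv hL) namul_suml; congr (_ - _).
by rewrite big_seq [RHS]big_seq; apply: eq_bigr => f /hl <-; rewrite -namulA (esv hL).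
Qed.
Lemma cut_idem : cut w l ** cut w l = cut w l.
Proof.
rewrite {2}/cut namulBr cut_v namul_sumr big_seq big1 ?subr0 // => f fl.
by rewrite namulA cut_e // namul0l.
Qed.
End Cut.

Lemma is_vHE (H : E0 -> Prop) w y : is_vH r s v e es H w y <->
  exists l, [/\ uniq l, (forall f, f \in l <-> s f = w /\ ~ H (r f)) & y = cut w l].
Proof.
split=> [[l [/NoDup_uniq ul [hl ->]]]|[l [/NoDup_uniq ul hl ->]]]; exists l.
  by split => // f; rewrite -hl; split => /In_mem.
by split => //; split => // f; rewrite -hl; split => /In_mem.
Qed.

Lemma is_vH_idem (H : E0 -> Prop) w y : is_vH r s v e es H w y -> y ** y = y.
Proof. by move/is_vHE => [l [ul hl ->]]; apply: cut_idem => // f /hl []. Qed.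

Lemma ev_exists d w c (l : seq (K * seq E1)) : walk w c -> endpt w c = w ->
  (forall t, t \in l -> exists k, t.2 = per d c (k * size c)) ->
  exists F, \sum_(t <- l) t.1 *: rpath w t.2 = ev w c F.
Proof.
move=> hc rc; elim: l => [|t l IH] hl; first by exists 0; rewrite big_nil ev0.
have [|F hF] := IH; first by move=> t' h; apply: hl; rewrite in_cons h orbT.
have [k hk] := hl t (mem_head _ _).
exists (t.1 *: 'X^k + F); rewrite big_cons hF ev_lin evXn hk.
by rewrite (cpow_per hL hc rc d).
Qed.

Section StructureThm.
Variables (I J : A -> Prop).
Notation H := (fun u => I (v u)).
Hypotheses (hI : is_ideal I) (hJ : is_ideal J) (hJI : Defs.subset J I).
Hypothesis hJH : forall u, I (v u) -> J (v u).
Hypothesis hJB : forall u y, BH r s H u -> is_vH r s v e es H u y -> I y -> J y.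
Hypothesis hJc : forall w c F, qual_at H w c -> I (ev w c F) -> J (ev w c F).

Lemma structure_real w x : real_span x -> I x -> x ** v w = x -> J x.
Proof.
move=> Rx Ix xw; apply: contrapT => nJ.
have hw : ~ I (v w) by move=> /hJH Jw; apply: nJ; rewrite -xw; apply: (idealMl hJ).
have [a [[k [l [k0 hl eq]]] nJa]] := left_reduce_real_span hL hJ Rx xw nJ.
have Ia : I (a ** x) by apply: (idealMl hI).
have nonempty : exists q, q \in [seq t.2 | t <- l].
  case: (l) eq => [|t l'] eq; last by exists t.2; rewrite mem_head.
  by case: hw; apply: (ideal_scaleP hL hI k0); move: Ia; rewrite eq big_nil addr0.
have [d _] : exists d : E1, True.
  by case: nonempty => q /mapP [t /hl [] ]; case: (t.2) => // d ? ? ? ? ?; exists d.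
have hG q : q \in [seq t.2 | t <- l] -> [/\ q != [::], walk w q & endpt w q = w].
  by case/mapP => t /hl h ->.
have hH := ideal_edge_closed hL hI.
have [|c hc hq] := periodic_cycle d hH hw hG.
  (* If p is a prefix of no g p with g a closed path in the combination, then p^* g p = 0 for all
     these g, and k r(p) = p^* (a x) p lies in [I]. *)
  move=> p hp hr; apply: contrapT => hn; apply: hr; apply: (ideal_scaleP hL hI k0).
  have -> : k *: v (endpt w p) = gpath w p ** (a ** x) ** rpath w p.
    rewrite eq namulDr namulDl namulZr namulZl (gpath_r hL) // (gpath_rpath hL) //.
    rewrite namul_sumr namul_suml big_seq big1 ?addr0 // => t tl.
    have [t0 ht rt] := hl t tl.
    have := rpath_cat hL (u := w) (p := t.2) (q := p); rewrite rt => /(_ hp) tp.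
    rewrite namulZr namulZl -namulA tp (gpath_pe0 hL) ?scaler0 //.
    - by rewrite walk_cat ht rt.
    - by rewrite size_cat leq_addl.
    - by apply/negP => hpre; apply: hn; exists t.2 => //; apply: map_f.
  by apply: (idealMr hI); apply: (idealMl hI).
have [cyc_c _ _] := hc; have /and4P[_ wc /eqP rc _] := cyc_c.
have [t tl|F hF] := @ev_exists d w c l wc rc; first exact/hq/map_f.
apply: nJa; have -> : a ** x = ev w c (k%:P + F) by rewrite evD ev_C eq hF.
by apply: hJc => //; rewrite evD ev_C -hF -eq.
Qed.

(** A ghost edge at the right end meets [e f] and becomes a vertex or 0. *)
Lemma ghost_le_drop n x f : ghost_le n.+1 x -> ghost_le n (x ** e f).
Proof.
move=> [p [l [hp [hl ->]]]]; rewrite namulDl namul_suml.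
apply: ghost_le_add; first exact/ghost_le_real_span/(real_span_e hL).
apply: ghost_le_sum => t /hl ht; rewrite -namulA.
have [<-|tu] := eqVneq t.1 f; first by rewrite (ese hL); apply: (ghost_le_v hL).
by rewrite (ese0 hL) // namul0r; apply/ghost_le_real_span/real_span0.
Qed.

Lemma structure_sub : Defs.subset I J.
Proof.
move=> x; have [n hn] := ghost_le_all hL x; elim: n x hn => [|n IH] x hx Ix.
  apply: (ideal_vr hL hJ) => w; apply: (@structure_real w).
  - exact: (real_span_v hL).
  - exact: (idealMr hI).
  - by rewrite -namulA (vv hL).
apply: (ideal_vr hL hJ) => w.
have {hx} : ghost_le n.+1 (x ** v w) by apply: (ghost_le_v hL).
have {Ix} : I (x ** v w) by apply: (idealMr hI).
have : x ** v w ** v w = x ** v w by rewrite -namulA (vv hL).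
move: (x ** v w) => {}x xw Ix hx.
have Jxe f : J (x ** e f) by apply: IH; [apply: ghost_le_drop | apply: (idealMr hI)].
have Jxes f : J (x ** (e f ** es f)) by rewrite namulA; apply: (idealMr hJ).
(* At a regular vertex x is the sum of all x f f^*, which lie in [J]. *)
have [rw|nrw] := EM (regular s w).
  have [/fin_set_seq [l [ul hl]] _] := rw.
  rewrite -xw (CK2 hL rw ul); last by move=> f; apply/idP/eqP => /hl.
  by rewrite namul_sumr; apply: (ideal_sum hJ) => f _.
(* Modulo [J], multiplication by a cut does not change x. *)
have Jcut l : J (x ** cut w l) -> J x.
  rewrite namulBr xw; apply: (idealBr hJ); rewrite namul_sumr.
  exact: (ideal_sum hJ).
apply: contrapT => nJ.
have hw : ~ I (v w) by move=> /hJH Jw; apply: nJ; rewrite -xw; apply: (idealMl hJ).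
have hH := ideal_edge_closed hL hI.
have [p [L [hp [hL' ex]]]] := hx.
pose P := p ** v w.
have RP : real_span P by apply: (real_span_v hL).
have Pw : P ** v w = P by rewrite /P -namulA (vv hL).
(* The ghost terms y f^* of x contribute nothing modulo [J]: the cut annihilates f^* if f is in [l]
   or does not leave [w], and the other f end in a vertex of [I], hence of [J]. *)
have xP l : uniq l -> (forall f, f \in l -> s f = w) ->
    (forall t, t \in L -> s t.1 = w -> t.1 \notin l -> I (v (r t.1))) ->
    J (x ** cut w l - P ** cut w l).
  move=> ul sl hl; rewrite ex namulDl /P -namulA (v_cut sl) addrC addKr namul_suml.
  apply: (ideal_sum hJ) => t tL; rewrite -namulA.
  have [st|st] := eqVneq (s t.1) w; last by rewrite (s_cut0 sl) // namul0r; apply: (ideal0 hJ).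
  case: (boolP (t.1 \in l)) => tl; first by rewrite (s_cut ul sl) // namul0r; apply: (ideal0 hJ).
  apply: (idealMl hJ); apply: (idealMr hJ); rewrite -(vre hL); apply: (idealMr hJ).
  by apply: hJH; apply: hl.
have nJP l : uniq l -> (forall f, f \in l -> s f = w) ->
    (forall t, t \in L -> s t.1 = w -> t.1 \notin l -> I (v (r t.1))) -> ~ J P.
  move=> ul sl hl JP; apply: nJ; apply: (Jcut l).
  by apply: (idealBr hJ) (xP l ul sl hl); apply: (idealMr hJ).
(* If only finitely many edges from [w] end outside [I], the list [l] of these makes the cut equal
   to w^H. *)
have [fin|inf] := EM (fin_set (fun f => s f = w /\ ~ I (v (r f)))).
  have /fin_set_seq [l [ul hl]] := fin.
  have sl f : f \in l -> s f = w by move/hl => [].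
  have hl' t : t \in L -> s t.1 = w -> t.1 \notin l -> I (v (r t.1)).
    by move=> _ st; apply: contraNP => nr; apply/hl.
  have [a [[k [G [k0 hG eq]]] _]] := left_reduce_real_span hL hJ RP Pw (nJP l ul sl hl').
  have Icut : I (cut w l).
    apply: (ideal_scaleP hL hI k0).
    (* A closed path at [w] begins with an edge of [l], since it returns to a vertex outside [I]; so
       the cut annihilates it and only the constant term survives. *)
    have -> : k *: cut w l = cut w l ** (a ** P) ** cut w l.
      have E (z a' b' : A) : z ** (k *: a' + b') ** z = k *: (z ** a' ** z) + z ** b' ** z.
        by rewrite namulDr namulDl namulZr namulZl.
      rewrite eq E (cut_v sl) (cut_idem ul sl).
      rewrite namul_sumr namul_suml big_seq big1 ?addr0 // => -[b q] /hG /= [q0 hq rq].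
      rewrite namulZr; case: q q0 hq rq => //= f q _ /andP[/eqP sf hq] rq.
      rewrite namulA (cut_e ul sl) ?namul0l ?scaler0 ?namul0l //.
      apply/hl; split=> // /(edge_closed_endpt hH hq) Irl.
      by apply: hw; rewrite -rq.
    rewrite -(namulA (cut w l)) -(namulA a); do 2!apply: (idealMl hI).
    rewrite -(subKr (x ** cut w l) (P ** cut w l)); apply: (idealB hI).
      exact: (idealMr hI).
    exact: hJI (xP l ul sl hl').
  have hv : is_vH r s v e es (fun u => I (v u)) w (cut w l).
    by apply/is_vHE; exists l; split=> // f; split=> /hl.
  apply: nJ; apply: (Jcut l); apply: (idealMl hJ); apply: hJB (hv) (Icut).
  (* An empty [l] would make the cut equal to [w], which is not in [I]. *)
  case El : l => [|f l'].
    by case: hw; move: Icut; rewrite El /cut big_nil subr0.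
  have fl : f \in l by rewrite El mem_head.
  split; first by move=> fw; apply: nrw; split => //; exists f; exact: sl.
  by split => //; split => //; exists f; apply/hl.
(* Among the infinitely many edges from [w] that end outside [I], some f is neither the last ghost
   edge of a term of x nor the first edge of a closed path in a P. Then k r(f) = f^* (a P) f = f^* a
   x f lies in [I], a contradiction. *)
pose l := undup [seq t.1 | t <- L & s t.1 == w].
have ml f : f \in l -> s f = w.
  by rewrite mem_undup => /mapP [t]; rewrite mem_filter => /andP[/eqP <- _] ->.
have lm t : t \in L -> s t.1 = w -> t.1 \notin l -> I (v (r t.1)).
  move=> tL /eqP st; rewrite mem_undup => /mapP []; exists t => //.
  by rewrite mem_filter st.
have [a [[k [G [k0 hG eq]]] _]] :=
  left_reduce_real_span hL hJ RP Pw (nJP l (undup_uniq _) ml lm).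
pose heads := pmap (fun t : K * seq E1 => ohead t.2) G.
have [f [sf nf fl fh]] : exists f, [/\ s f = w, ~ I (v (r f)), f \notin l & f \notin heads].
  apply: contrapT => hn; apply: inf; exists (l ++ heads) => f [sf nf].
  apply/In_mem; rewrite mem_cat; apply: contrapT => /negP; rewrite negb_or => /andP[h1 h2].
  by apply: hn; exists f.
apply: nf; apply: (ideal_scaleP hL hI k0).
have -> : k *: v (r f) = es f ** (a ** P) ** e f.
  have E (z z' a' b' : A) : z ** (k *: a' + b') ** z' = k *: (z ** a' ** z') + z ** b' ** z'.
    by rewrite namulDr namulDl namulZr namulZl.
  rewrite eq E -{1}sf (esv hL) (ese hL).
  rewrite namul_sumr namul_suml big_seq big1 ?addr0 // => -[b q] tG.
  have /= [q0 hq rq] := hG _ tG.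
  rewrite namulZr; case: q q0 hq rq tG => //= g q _ _ _ tG.
  rewrite namulA (ese0 hL) ?namul0l ?scaler0 ?namul0l //.
  apply: contraNneq fh => ->; rewrite mem_pmap; apply/mapP.
  by exists (b, g :: q).
have -> : es f ** (a ** P) ** e f = es f ** a ** (x ** e f).
  rewrite /P -!namulA; congr (_ ** (_ ** _)); rewrite -{1}sf (vse hL) ex namulDl.
  rewrite namul_suml big_seq big1 ?addr0 // => t tL.
  rewrite -namulA (ese0 hL) ?namul0r //; apply: contraNneq fl => tf.
  rewrite mem_undup; apply/mapP; exists t => //.
  by rewrite mem_filter tL tf sf eqxx.
by apply: (idealMl hI); apply: (idealMr hI).
Qed.
End StructureThm.
End Ideals.

(** * Twisted Chen modules *)

Section Representation.
Variables (K : fieldType) (E0 E1 : eqType) (r s : E1 -> E0).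
Variables (A : nalg K) (v : E0 -> A) (e es : E1 -> A).
Hypothesis hL : is_LPA r s v e es.

Definition is_rep (V : lmodType K) (Phi : A -> V -> V) :=
  [/\ forall k x y phi, Phi (k *: x + y) phi = k *: Phi x phi + Phi y phi,
      forall x y phi, Phi (x ** y) phi = Phi x (Phi y phi) &
      forall x k phi psi, Phi x (k *: phi + psi) = k *: Phi x phi + Phi x psi].

(** The linear maps [V -> V] form an algebra in which the given operators satisfy the defining
    relations, so the universal property provides the action. *)
Lemma rep_exists (V : lmodType K) (Ov : E0 -> V -> V) (Oe Os : E1 -> V -> V) :
  (forall u k phi psi, Ov u (k *: phi + psi) = k *: Ov u phi + Ov u psi) ->
  (forall f k phi psi, Oe f (k *: phi + psi) = k *: Oe f phi + Oe f psi) ->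
  (forall f k phi psi, Os f (k *: phi + psi) = k *: Os f phi + Os f psi) ->
  (forall u phi, Ov u (Ov u phi) = Ov u phi) ->
  (forall u w phi, u != w -> Ov u (Ov w phi) = 0) ->
  (forall f phi, Ov (s f) (Oe f phi) = Oe f phi) ->
  (forall f phi, Oe f (Ov (r f) phi) = Oe f phi) ->
  (forall f phi, Ov (r f) (Os f phi) = Os f phi) ->
  (forall f phi, Os f (Ov (s f) phi) = Os f phi) ->
  (forall f phi, Os f (Oe f phi) = Ov (r f) phi) ->
  (forall f g phi, f != g -> Os f (Oe g phi) = 0) ->
  (forall u l phi, uniq l -> (forall f, (f \in l) = (s f == u)) ->
    Ov u phi = \sum_(f <- l) Oe f (Os f phi)) ->
  exists Phi : A -> V -> V, [/\ is_rep Phi, Phi \o v = Ov, Phi \o e = Oe & Phi \o es = Os].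
Proof.
move=> lv le ls rvv rvw rse rer rrs rss rse1 rse0 rck.
pose U : lmodType K := V -> V.
pose P (T : U) := forall k phi psi, T (k *: phi + psi) = k *: T phi + T psi.
pose mul (S T : U) : U := fun phi => S (T phi).
have P0 : P 0 by move=> k phi psi; rewrite /= scaler0 addr0.
have PD k S T : P S -> P T -> P (k *: S + T).
  move=> hS hT a phi psi.
  rewrite -[LHS]/(k *: S _ + T _) -[RHS]/(a *: (k *: S phi + T phi) + (k *: S psi + T psi)).
  by rewrite hS hT !scalerDr !scalerA (mulrC k) addrACA.
have PM S T : P S -> P T -> P (mul S T) by move=> hS hT a phi psi; rewrite /mul hT hS.
have MA S T W : P S -> P T -> P W -> mul S (mul T W) = mul (mul S T) W by [].
have MDl k S T W : P S -> P T -> P W -> mul (k *: S + T) W = k *: mul S W + mul T W by [].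
have MDr k S T W : P S -> P T -> P W -> mul S (k *: T + W) = k *: mul S T + mul S W.
  by move=> hS _ _; apply/funext => phi; apply: hS.
pose B := sub_nalg P0 PD PM MA MDl MDr.
pose inj := sub_in P0 PD PM MA MDl MDr.
have hB : lp_rel r s (fun u => inj (Ov u) (lv u)) (fun f => inj (Oe f) (le f))
    (fun f => inj (Os f) (ls f)).
  split; first by move=> u; apply/val_inj/funext => phi; apply: rvv.
  split; first by move=> u w /eqP uw; apply/val_inj/funext => phi; apply: rvw.
  split; first by move=> f; split; apply/val_inj/funext => phi; [apply: rse | apply: rer].
  split; first by move=> f; split; apply/val_inj/funext => phi; [apply: rrs | apply: rss].
  split; first by move=> f; apply/val_inj/funext => phi; apply: rse1.
  split; first by move=> f g /eqP fg; apply/val_inj/funext => phi; apply: rse0.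
  move=> u l hu /NoDup_uniq ul hm; apply/val_inj/funext => phi.
  apply: etrans (rck u l phi ul _) _.
    by move=> f; apply/idP/eqP => [/In_mem/hm|/hm/In_mem].
  apply: etrans (esym (congr1 (fun T : U => T phi) (sub_val_sum P0 PD _ _))).
  by rewrite fct_sumE.
have [[phi [[phiD phiM] [hv [he hs]]]] _] := (proj2 hL) _ _ _ _ hB.
exists (fun x => sub_val (phi x)); split.
- split=> [k x y psi|x y psi|x]; first by rewrite phiD.
    by rewrite phiM.
  exact: (sub_valPP (phi x)).
- by apply/funext => u /=; rewrite hv.
- by apply/funext => f /=; rewrite he.
- by apply/funext => f /=; rewrite hs.
Qed.

End Representation.

Section Chen.
Variables (K : fieldType) (E0 E1 : eqType) (r s : E1 -> E0).
Variables (A : nalg K) (v : E0 -> A) (e es : E1 -> A).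
Hypothesis hL : is_LPA r s v e es.
Variables (H : E0 -> Prop) (w : E0) (c : seq E1) (g b : {poly K}) (d : E1).
Hypotheses (hH : edge_closed r s H) (hc : qual_at r s H w c).
Hypothesis hb : ('X * b) %% g = 1 %% g.
Notation ipath := (nat -> E1).
Implicit Types (q : ipath) (f : E1) (u : E0) (P : E0 -> Prop) (F : {poly K}).
Local Notation V := (ipath -> {poly K}).
Implicit Types (phi : V).

Definition tail_in q := (forall n, r (q n) = s (q n.+1)) /\
  exists N, forall n, (N <= n)%N -> q n \in c.
Definition qshift n q : ipath := fun j => q (j + n)%N.
Definition qcons f q : ipath := fun j => if j is j'.+1 then q j' else f.
Notation e0 := (nth d c 0).
(* The first edge of [c] carries multiplication by ['X], so that [c] acts on the
   periodic path as ['X]; [b] is its inverse modulo [g]. *)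
Definition twist f : {poly K} := if f == e0 then 'X else 1.
Definition twist' f : {poly K} := if f == e0 then b else 1.
(** The elements of [V] are arbitrary functions with unreduced values. In place of a submodule of a
    quotient, each operator discards the sequences that are not paths with tail in c and reduces
    modulo [g]; the relations then hold on all of [V]. *)
Definition Ov u phi : V := fun q => if `[< tail_in q /\ s (q 0) = u >] then phi q %% g else 0.
Definition Oe f phi : V := fun q =>
  if `[< tail_in q /\ q 0 = f >] then (twist f * phi (qshift 1 q)) %% g else 0.
Definition Os f phi : V := fun q =>
  if `[< tail_in q /\ s (q 0) = r f >] then (twist' f * phi (qcons f q)) %% g else 0.

Lemma tail_shift n q : tail_in q -> tail_in (qshift n q).
Proof.
move=> [h1 [N h2]]; split=> [j|]; first exact: h1.
by exists N => j hj; apply: h2; rewrite (leq_trans hj) // leq_addr.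
Qed.
Lemma tail_cons f q : tail_in q -> s (q 0) = r f -> tail_in (qcons f q).
Proof.
move=> [h1 [N h2]] hf; split=> [[|j]|] //=.
by exists N.+1 => -[|j] //; rewrite ltnS; apply: h2.
Qed.
Lemma shift_cons f q : qshift 1 (qcons f q) = q.
Proof. by apply/funext => j; rewrite /qshift addn1. Qed.
Lemma cons_shift q : qcons (q 0) (qshift 1 q) = q.
Proof. by apply/funext => -[|j] //=; rewrite /qshift addn1. Qed.

(** A path that starts in [P] stays there, but its tail runs through vertices of c. *)
Lemma tail_avoid P q : edge_closed r s P -> (forall f, f \in c -> ~ P (s f)) ->
  tail_in q -> ~ P (s (q 0)).
Proof.
move=> hP hcP [h1 [N h2]] h0; have hn n : P (s (q n)).
  by elim: n => // n IH; rewrite -h1; apply: hP.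
exact: (hcP _ (h2 _ (leqnn N)) (hn N)).
Qed.

Lemma twistK f (F : {poly K}) : (twist f * (twist' f * F)) %% g = F %% g.
Proof.
rewrite mulrA /twist /twist'; case: eqP => _; last by rewrite !mul1r.
by rewrite mulrC -modp_mul hb modp_mul mulr1.
Qed.

Lemma if_lin (Q : bool) k F G :
  (if Q then (k *: F + G) %% g else 0) =
  k *: (if Q then F %% g else 0) + (if Q then G %% g else 0).
Proof. by case: Q; rewrite ?modpD ?modpZl // scaler0 addr0. Qed.

(** The twist and its inverse cancel, so f f^* is the projection to the paths that begin with f, up
    to reduction modulo [g]. *)
Lemma OeOs f phi q :
  Oe f (Os f phi) q = if `[< tail_in q /\ q 0 = f >] then phi q %% g else 0.
Proof.
rewrite /Oe; case: asboolP => // -[hq qf]; rewrite /Os asboolT.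
  by rewrite modp_mul twistK -qf cons_shift.
by split; [apply: tail_shift | rewrite /qshift -qf; case: hq => ->].
Qed.

Lemma OeOs_sum (l : seq E1) phi q : uniq l ->
  \sum_(f <- l) Oe f (Os f phi) q =
  if `[< tail_in q /\ q 0 \in l >] then phi q %% g else 0.
Proof.
move=> ul; under eq_bigr do rewrite OeOs.
case: asboolP => [[hq ql]|hn].
  rewrite (bigD1_seq (q 0)) //= asboolT // big1 ?addr0 // => f fq.
  by case: asboolP => // -[_ qf]; rewrite qf eqxx in fq.
rewrite big_seq big1 // => f fl; case: asboolP => // -[hq qf].
by case: hn; rewrite qf.
Qed.

Lemma chen_rep : exists Phi : A -> V -> V,
  [/\ is_rep Phi, Phi \o v = Ov, Phi \o e = Oe & Phi \o es = Os].
Proof.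
apply: (rep_exists hL).
- by move=> u k phi psi; apply/funext => q; apply: if_lin.
- move=> f k phi psi; apply/funext => q; rewrite /Oe mulrDr -scalerAr; exact: if_lin.
- move=> f k phi psi; apply/funext => q; rewrite /Os mulrDr -scalerAr; exact: if_lin.
- by move=> u phi; apply/funext => q; rewrite /Ov; case: asboolP => // _; rewrite modp_id.
- move=> u u' phi /eqP uw; apply/funext => q; rewrite /Ov; case: asboolP => // -[_ su].
  by case: asboolP => [[_ sw]|_]; rewrite ?mod0p //; case: uw; rewrite -su.
- move=> f phi; apply/funext => q; rewrite /Ov /Oe; case: asboolP => h1.
    by case: asboolP => _; rewrite ?modp_id ?mod0p.
  by case: asboolP => // -[hq qf]; case: h1; rewrite qf.
- move=> f phi; apply/funext => q; rewrite /Ov /Oe; case: asboolP => // -[hq qf].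
  rewrite asboolT ?modp_mul //; split; first exact: tail_shift.
  by rewrite /qshift -qf; case: hq => ->.
- move=> f phi; apply/funext => q; rewrite /Ov /Os; case: asboolP => // h1.
  by rewrite modp_id.
- move=> f phi; apply/funext => q; rewrite /Ov /Os; case: asboolP => // -[h1 h2].
  by rewrite asboolT ?modp_mul //; split => //; apply: tail_cons.
- move=> f phi; apply/funext => q; rewrite /Ov /Os /Oe; case: asboolP => // -[h1 h2].
  rewrite asboolT; last by split => //; apply: tail_cons.
  by rewrite modp_mul shift_cons mulrCA twistK.
- move=> f f' phi /eqP ff; apply/funext => q; rewrite /Os /Oe; case: asboolP => // _.
  by case: asboolP => [[_ h]|_]; rewrite ?mulr0 ?mod0p //; case: ff.
- move=> u l phi ul hl; apply/funext => q; rewrite fct_sumE OeOs_sum //.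
  rewrite /Ov; congr (if _ then _ else _); apply: asbool_equiv_eq.
  by rewrite hl; split=> -[hq /eqP].
Qed.

Section Rep.
Variable Phi : A -> V -> V.
Hypothesis hPhi : is_rep Phi.
Hypotheses (Phiv : Phi \o v = Ov) (Phie : Phi \o e = Oe) (Phis : Phi \o es = Os).

Let Phi_v u : Phi (v u) = Ov u. Proof. exact: (congr1 (fun T => T u) Phiv). Qed.
Let Phi_e f : Phi (e f) = Oe f. Proof. exact: (congr1 (fun T => T f) Phie). Qed.
Let Phi_s f : Phi (es f) = Os f. Proof. exact: (congr1 (fun T => T f) Phis). Qed.

Lemma PhiM x y phi : Phi (x ** y) phi = Phi x (Phi y phi).
Proof. by case: hPhi. Qed.
Lemma Phi0l phi : Phi 0 phi = 0.
Proof.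
case: hPhi => h _ _; have := h (-1) 0 0 phi.
by rewrite scaler0 addr0 scaleN1r addNr.
Qed.
Lemma Phi0r x : Phi x 0 = 0.
Proof.
case: hPhi => _ _ h; have := h x (-1) 0 0.
by rewrite scaler0 addr0 scaleN1r addNr.
Qed.
Lemma PhiD x y phi : Phi (x + y) phi = Phi x phi + Phi y phi.
Proof. by case: hPhi => h _ _; have := h 1 x y phi; rewrite !scale1r. Qed.
Lemma PhiZ k x phi : Phi (k *: x) phi = k *: Phi x phi.
Proof. by case: hPhi => h _ _; have := h k x 0 phi; rewrite !addr0 Phi0l addr0. Qed.
Lemma PhiB x y phi : Phi (x - y) phi = Phi x phi - Phi y phi.
Proof. by rewrite PhiD -scaleN1r PhiZ scaleN1r. Qed.
Lemma Phi_sum (T : Type) (l : seq T) (G : T -> A) phi :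
  Phi (\sum_(i <- l) G i) phi = \sum_(i <- l) Phi (G i) phi.
Proof.
by apply: (big_morph (fun x => Phi x phi)) => [x y|]; [apply: PhiD | apply: Phi0l].
Qed.

Definition chen_ann x := forall phi, Phi x phi = 0.

Lemma chen_ann_ideal : is_ideal chen_ann.
Proof.
split; first exact: Phi0l.
split; first by move=> x y hx hy phi; rewrite PhiB hx hy subrr.
by move=> a x hx; split => phi; rewrite PhiM hx ?Phi0r.
Qed.

Lemma chen_ann_v P u : edge_closed r s P -> (forall f, f \in c -> ~ P (s f)) ->
  P u -> chen_ann (v u).
Proof.
move=> hP hcP Pu phi; rewrite Phi_v; apply/funext => q; rewrite /Ov.
by case: asboolP => // -[hq su]; case: (tail_avoid hP hcP hq); rewrite su.
Qed.

(** A path from [u] with tail in c never meets [P], so its first edge is in [l]; the projections f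
    f^* therefore add up to the action of [u]. *)
Lemma chen_ann_vH P u y : edge_closed r s P -> (forall f, f \in c -> ~ P (s f)) ->
  is_vH r s v e es P u y -> chen_ann y.
Proof.
move=> hP hcP /is_vHE [l [ul hl ->]] phi; rewrite PhiB Phi_v Phi_sum.
under eq_bigr do rewrite PhiM Phi_e Phi_s.
apply/eqP; rewrite subr_eq0; apply/eqP/funext => q.
rewrite fct_sumE OeOs_sum // /Ov; congr (if _ then _ else _).
apply: asbool_equiv_eq; split=> -[hq]; last by move/hl => [].
move=> su; split => //; apply/hl; split => // hr.
apply: (tail_avoid hP hcP (tail_shift 1 hq)).
by rewrite /qshift; case: hq => <-.
Qed.

(** Such a path never meets [H], so all its initial segments follow c. *)
Lemma tail_per q : tail_in q -> s (q 0) = w -> forall j, q j = nth d c (j %% size c).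
Proof.
move=> hq sq; have hwp L : walk r s w (mkseq q L) /\ endpt r w (mkseq q L) = s (q L).
  elim: L => [|L [IH1 IH2]] //.
  by rewrite mkseqS endpt_rcons -cats1 walk_cat IH1 /= IH2 eqxx; case: hq => ->.
move=> j; have [h1 h2] := hwp j.+1.
have nH : ~ H (endpt r w (mkseq q j.+1)).
  rewrite h2 -[j.+1]add0n; apply: (tail_avoid hH _ (tail_shift j.+1 hq)).
  by case: hc.
have := congr1 (fun l => nth d l j) (qual_at_follow d hH hc h1 nH).
by rewrite size_mkseq nth_mkseq // nth_per.
Qed.

Lemma Phi_rpath u (p : seq E1) phi q : walk r s u p ->
  Phi (rpath r v e u p) phi q =
  if `[< tail_in q /\ s (q 0) = u /\ forall j, (j < size p)%N -> q j = nth d p j >]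
  then ((\prod_(f <- p) twist f) * phi (qshift (size p) q)) %% g else 0.
Proof.
elim: p u q => [|f p IH] u q /=.
  move=> _; rewrite Phi_v /Ov big_nil mul1r.
  have -> : qshift 0 q = q by apply/funext => j; rewrite /qshift addn0.
  by congr (if _ then _ else _); apply: asbool_equiv_eq; split=> [[]|[? []]].
case/andP=> /eqP sf hp; rewrite PhiM Phi_e /Oe; case: asboolP => [[hq qf]|h1]; last first.
  by case: asboolP => // -[hq [_ h]]; case: h1; split => //; apply: (h 0).
rewrite IH // big_cons -mulrA.
have -> : qshift (size p) (qshift 1 q) = qshift (size p).+1 q.
  by apply/funext => j; rewrite /qshift addn1 addnS.
case: asboolP => [[h2 [h3 h4]]|h2].
  rewrite asboolT ?modp_mul //; split => //; split; first by rewrite qf.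
  by move=> [|j] //= hj; rewrite -h4 // /qshift addn1.
rewrite asboolF ?mulr0 ?mod0p // => -[_ [_ h4]]; apply: h2.
split; first exact: tail_shift.
split; first by rewrite /qshift -qf; case: hq => ->.
by move=> j hj; rewrite /qshift addn1; apply: (h4 j.+1).
Qed.

(** The cycle passes its first edge once, which gives one factor ['X], and the shift by [size c]
    fixes the periodic path, the only path from [w] with tail in c. *)
Lemma Phi_cycle phi q : Phi (rpath r v e w c) phi q =
  if `[< tail_in q /\ s (q 0) = w >] then ('X * phi q) %% g else 0.
Proof.
have [cyc_c _ _] := hc; have /and4P[_ wc _ /map_uniq uc] := cyc_c.
rewrite Phi_rpath //.
have -> : \prod_(f <- c) twist f = 'X.
  rewrite (bigD1_seq e0) ?mem_nth ?(cyc_size cyc_c) //= /twist eqxx big1 ?mulr1 // => f.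
  by move/negbTE => ->.
case: asboolP => [[hq [sq h]]|h1]; last first.
  rewrite asboolF // => -[hq sq]; apply: h1; split => //; split => // j hj.
  by rewrite (tail_per hq sq) modn_small.
rewrite asboolT //; congr ((_ * phi _) %% _); apply/funext => j.
by rewrite /qshift !(tail_per hq sq) modnDr.
Qed.

Lemma Phi_ev F phi q : Phi (ev r v e w c F) phi q =
  if `[< tail_in q /\ s (q 0) = w >] then (F * phi q) %% g else 0.
Proof.
elim/poly_ind: F phi q => [|F k IH] phi q.
  by rewrite ev0 Phi0l mul0r mod0p; case: asboolP.
rewrite evD evMX ev_C PhiD PhiZ PhiM -[LHS]/(_ q + k *: _ q) Phi_cycle IH Phi_v /Ov.
case: asboolP => _; last by rewrite scaler0 addr0.
by rewrite modp_mul mulrDl modpD mul_polyC modpZl mulrA (mulrC 'X).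
Qed.

Lemma chen_ann_ev F : chen_ann (ev r v e w c F) <-> g %| F.
Proof.
have [cyc_c _ _] := hc; have sc := cyc_size cyc_c.
split=> [h|hg phi]; last first.
  apply/funext => q; rewrite Phi_ev; case: asboolP => // _.
  by apply/eqP; rewrite -/(g %| _) dvdp_mulr.
(* Applied to the constant function 1 and evaluated at the periodic path, F(c) returns F modulo
   [g]. *)
have := congr1 (fun T => T (fun j => nth d c (j %% size c))) (h (fun=> 1)).
rewrite Phi_ev asboolT ?mulr1 => [h0|]; first by rewrite /dvdp -[_ %% _]/(F %% g) h0.
split; last by rewrite mod0n (cyc_head d cyc_c).
split; last by exists 0%N => n _; rewrite mem_nth // ltn_mod.
by move=> n; rewrite (cyc_next d cyc_c) ?ltn_mod // -addn1 modnDml addn1.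
Qed.

End Rep.
End Chen.

(** The set [P] is kept variable because it is also taken to be the vertex set of another ideal, or
    a set enlarged by the vertices of a second cycle. *)
Lemma chen (K : fieldType) (E0 E1 : eqType) (r s : E1 -> E0) (A : nalg K)
  (v : E0 -> A) (e es : E1 -> A) (hL : is_LPA r s v e es)
  (H : E0 -> Prop) (w : E0) (c : seq E1) (g : {poly K}) :
  edge_closed r s H -> qual_at r s H w c -> g`_0 != 0 ->
  exists J : A -> Prop, [/\ is_ideal J,
    forall P u, edge_closed r s P -> (forall f, f \in c -> ~ P (s f)) -> P u -> J (v u),
    forall P u y, edge_closed r s P -> (forall f, f \in c -> ~ P (s f)) ->
      is_vH r s v e es P u y -> J y &
    forall F : {poly K}, J (ev r v e w c F) <-> g %| F].
Proof.
move=> hH hc g0.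
have [d _] : exists d : E1, True.
  by case: hc => /cyc_size; case: (c) => // d *; exists d.
(* Since g = h X + g(0), the inverse of X modulo [g] is - h / g(0). *)
pose h := \poly_(i < (size g).-1) g`_i.+1.
have gE : g = h * 'X + (g`_0)%:P.
  apply/polyP => i; rewrite coefD coefMX coefC coef_poly; case: i => [|i]; first by rewrite add0r.
  rewrite addr0 /=; case: ltnP => // hi; rewrite nth_default //.
  by case: (size g) hi.
pose b := - (g`_0)^-1 *: h.
have hb : ('X * b) %% g = 1 %% g.
  have -> : 'X * b = 1 - (g`_0)^-1 *: g.
    have -> : 'X * b = - (g`_0)^-1 *: (g - (g`_0)%:P).
      by rewrite {2}gE addrK /b -scalerAr mulrC.
    rewrite scalerBr !scaleNr opprK addrC -(mul_polyC _ (g`_0)%:P) -polyCM mulVf //.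
  by rewrite modpD modpN modpZl modpp scaler0 subr0.
have [Phi [hPhi h1 h2 h3]] := chen_rep hL c d hb.
exists (chen_ann Phi); split.
- exact: chen_ann_ideal.
- by move=> P u hP hcP Pu; apply: (chen_ann_v h1 hP hcP Pu).
- by move=> P u y hP hcP hy; apply: (chen_ann_vH hb hPhi h1 h2 h3 hP hcP hy).
- by move=> F; apply: (chen_ann_ev hH hc hPhi h1 h2 F).
Qed.

(** * Corners at a cycle *)

Section Rotation.
Variables (E0 E1 : eqType) (r s : E1 -> E0).
Implicit Types (u w : E0) (f g : E1) (p q c : seq E1) (H : E0 -> Prop).
Notation walk := (walk r s).
Notation endpt := (endpt r).
Notation cyc := (cyc r s).
Notation qual_at := (qual_at r s).

Lemma same_cycleE c c' : same_cycle c c' <-> c =i c'.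
Proof.
split=> h f; first by apply/idP/idP => /In_mem/h/In_mem.
by rewrite !In_mem h.
Qed.

Lemma path_in_cyc d w c p : cyc w c -> walk w p -> {subset p <= c} -> p = per d c (size p).
Proof.
move=> hc; elim/last_ind: p => [|p f IH] //.
rewrite -cats1 walk_cat cats1 /= andbT => /andP[hp /eqP sf] hs.
have ep : p = per d c (size p).
  by apply: IH => // g gp; apply: hs; rewrite mem_rcons in_cons gp orbT.
rewrite size_rcons perS -ep; congr rcons.
have [_] := cyc_per d (size p) hc; rewrite -ep -sf => sfg.
apply: (cyc_inj hc) => //; first by apply: hs; rewrite mem_rcons mem_head.
by rewrite mem_nth // ltn_mod (cyc_size hc).
Qed.

Lemma cyc_rot w c f : cyc w c -> f \in c ->
  exists p q, [/\ c = p ++ f :: q, cyc (s f) (f :: q ++ p) & endpt w p = s f].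
Proof.
move=> hc fc; exists (take (index f c) c), (drop (index f c).+1 c).
have hi : (index f c < size c)%N by rewrite index_mem.
have ed : drop (index f c) c = f :: drop (index f c).+1 c.
  by rewrite (drop_nth f) // nth_index.
have /and4P[c0 wc /eqP rc uc] := hc.
have rt : endpt w (take (index f c) c) = s f by rewrite (endpt_take f wc hi) nth_index.
have [k1 k2] := walk_takedrop (index f c) wc.
have eqc : f :: drop (index f c).+1 c ++ take (index f c) c = rot (index f c) c.
  by rewrite /rot ed.
split => //; first by rewrite -ed cat_take_drop.
rewrite /cyc eqc map_rot rot_uniq uc andbT; apply/and3P; split.
- by rewrite -size_eq0 size_rot size_eq0.
- rewrite /rot walk_cat; rewrite rt in k2; rewrite k2 /=.
  have -> : endpt (s f) (drop (index f c) c) = w by rewrite -rt -endpt_cat cat_take_drop.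
  exact: k1.
- by rewrite /rot -rt endpt_cat -(endpt_cat _ w) cat_take_drop rc.
Qed.

Lemma cyc_uniq w c : cyc w c -> uniq c.
Proof. by case/and4P => _ _ _ /map_uniq. Qed.

(** From the same base vertex c' can only run along c again and again, so [size c] divides its
    length; its edges being distinct, it goes round once. *)
Lemma cyc_sub (d : E1) w c c' : cyc w c -> cyc w c' -> {subset c' <= c} -> c' = c.
Proof.
move=> hc hc' sub; have /and4P[_ wc' /eqP rc' _] := hc'.
have e1 := path_in_cyc d hc wc' sub.
have dv : (size c %| size c')%N by apply: (per_dvd (d := d) hc); rewrite -e1.
have sz : size c' = size c.
  apply/eqP; rewrite eqn_leq (uniq_leq_size (cyc_uniq hc') sub) /=.
  by rewrite dvdn_leq // (cyc_size hc').
by rewrite e1 sz -[in per _ _ _](addn0 (size c)) per_cat cats0.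
Qed.

Lemma cyc_same w w' c c' : cyc w c -> cyc w' c' -> c =i c' ->
  exists p q, [/\ c = p ++ q, c' = q ++ p & endpt w p = w'].
Proof.
move=> hc hc' cc'; have := hc'; case: c' cc' hc' => [|f c'] cc' hc' //.
have fc : f \in c by rewrite cc' mem_head.
have [p [q [ec hr rp]]] := cyc_rot hc fc.
have sf : s f = w' by rewrite -(cyc_head f hc').
move=> _; exists p, (f :: q); split => //; last by rewrite rp.
apply: (cyc_sub f (w := w')) => //; first by rewrite -sf.
by move=> g; rewrite -cc' ec !mem_cat orbC.
Qed.

Lemma qual_at_stay H w c u p f : qual_at H w c -> f \in c -> s f = u -> walk u p ->
  (forall g, g \in p -> ~ H (r g)) -> {subset p <= c}.
Proof.
move=> [hc h2 h3]; elim: p u f => [|g p IH] u f fc sf //= /andP[/eqP sg hp] hr.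
have gc : g \in c.
  apply: contraT => gc; case: (hr g (mem_head _ _)).
  by apply: h3 fc _ gc; rewrite sf.
have [g' gc' sg'] := cyc_succ hc gc.
have sub := IH _ _ gc' sg' hp (fun x hx => hr x (mem_behead (s := g :: p) hx)).
by move=> x; rewrite inE => /orP[/eqP ->|/sub].
Qed.

(** Rotated to the common vertex, c' starts on c, and it cannot leave c because its edges end
    outside [H]. *)
Lemma qual_at_meet H w w' c c' f f' : qual_at H w c -> cyc w' c' ->
  (forall g, g \in c' -> ~ H (s g)) -> f \in c -> f' \in c' -> s f = s f' -> c =i c'.
Proof.
move=> hq hc' hH fc fc' sf; have [hc _ _] := hq.
have [p [q [ec hr _]]] := cyc_rot hc fc.
have [p' [q' [ec' hr' _]]] := cyc_rot hc' fc'.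
have m : c =i f :: q ++ p by move=> g; rewrite ec -cat_cons !mem_cat orbC.
have m' : c' =i f' :: q' ++ p' by move=> g; rewrite ec' -cat_cons !mem_cat orbC.
have sub : {subset f' :: q' ++ p' <= c}.
  have /and4P[_ hw _ _] := hr'; apply: (qual_at_stay hq fc sf hw) => g.
  rewrite -m' => /(cyc_succ hc') [g' /hH hg' <-]; exact: hg'.
rewrite -sf in hr'; move=> g; rewrite m m' (cyc_sub f hr hr') // => x /sub.
by rewrite m.
Qed.

End Rotation.

(** * Products F(c) y G(c') of values at cycles *)

Section Corner.
Variables (K : fieldType) (E0 E1 : eqType) (r s : E1 -> E0).
Variables (A : nalg K) (v : E0 -> A) (e es : E1 -> A).
Hypothesis hL : is_LPA r s v e es.
Implicit Types (u w : E0) (f g : E1) (p q c : seq E1) (x y z : A) (F G : {poly K}).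
Notation walk := (walk r s).
Notation endpt := (endpt r).
Notation rpath := (rpath r v e).
Notation gpath := (gpath r v es).
Notation cyc := (cyc r s).
Notation qual_at := (qual_at r s).
Notation ev := (ev r v e).
Notation cpow := (cpow r v e).

(** This comes from (pq)^i p = p (qp)^i, multiplied by p^* on the left. *)
Lemma ev_rot w p q F : walk w (p ++ q) -> endpt w (p ++ q) = w ->
  ev (endpt w p) (q ++ p) F = gpath w p ** ev w (p ++ q) F ** rpath w p.
Proof.
rewrite walk_cat endpt_cat => /andP[hp hq] rq.
rewrite namul_sumr namul_suml; apply: eq_bigr => i _; rewrite namulZr namulZl.
have hqp : walk (endpt w p) (q ++ p) by rewrite walk_cat hq rq hp.
have rqp : endpt (endpt w p) (q ++ p) = endpt w p by rewrite endpt_cat rq.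
congr (_ *: _).
suff E : cpow w (p ++ q) i ** rpath w p = rpath w p ** cpow (endpt w p) (q ++ p) i.
  by rewrite -namulA E namulA (gpath_rpath hL) // (v_cpow hL).
elim: (nat_of_ord i) => {i} [|i IH] /=; first by rewrite (rpath_l hL) // (rpath_r hL).
rewrite -namulA IH !namulA -(rpath_cat hL hq).
have -> : rpath (endpt w p) (q ++ p) = rpath (endpt w p) q ** rpath w p.
  by have := rpath_cat hL (u := endpt w p) (p := q) (q := p); rewrite rq => ->.
by rewrite !namulA.
Qed.

(** Cycles with the same edges are rotations of each other, and [ev_rot] expresses one value through
    the other. *)
Lemma ev_same (I : A -> Prop) w w' c c' F : is_ideal I -> cyc w c -> cyc w' c' ->
  c =i c' -> I (ev w c F) -> I (ev w' c' F).
Proof.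
move=> hI hc hc' cc' h; have [p [q [ec ec' rp]]] := cyc_same hc hc' cc'.
have /and4P[_ wc /eqP rc _] := hc.
rewrite ec in wc rc; rewrite ec' -rp ev_rot // -ec.
by apply: (idealMr hI); apply: (idealMl hI).
Qed.

Lemma ideal_congr (Q : A -> Prop) x y a b : is_ideal Q -> Q (a - b) ->
  Q (x ** b ** y) -> Q (x ** a ** y).
Proof.
move=> hQ ab h; rewrite -(subrK b a) namulDr namulDl; apply: (idealD hQ) => //.
by apply: (idealMr hQ); apply: (idealMl hQ).
Qed.

Lemma ideal_subC (Q : A -> Prop) x y : is_ideal Q -> Q (x - y) <-> Q (y - x).
Proof. by move=> hQ; split=> /(idealN hQ); rewrite opprB. Qed.

(** Since c^* c is the base vertex, left multiplication by c^* removes a factor X; this is repeated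
    until the constant term is nonzero. *)
Lemma ev_const (I : A -> Prop) w c F : is_ideal I -> cyc w c -> F != 0 -> I (ev w c F) ->
  exists2 G : {poly K}, G`_0 != 0 & I (ev w c G).
Proof.
move=> hI hc; have /and4P[_ wc /eqP rc _] := hc.
elim/poly_ind: F => [|F k IH]; first by rewrite eqxx.
have [->|k0] := eqVneq k 0; last first.
  by move=> _ h; exists (F * 'X + k%:P); rewrite // coefD coefMX coefC add0r.
rewrite addr0 mulf_eq0 negb_or polyX_eq0 andbT => F0 h; apply: IH => //.
have -> : ev w c F = gpath w c ** ev w c (F * 'X).
  by rewrite evMX namulA (gpath_rpath hL) // rc (ev_v hL).
exact: (idealMl hI).
Qed.

Section NoExit.
Variables (I Q : A -> Prop).
Hypotheses (hI : is_ideal I) (hQ : is_ideal Q).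
Notation H := (fun u => I (v u)).
Hypothesis hQH : forall u, I (v u) -> Q (v u).
Hypothesis hQB : forall u y, BH r s H u -> is_vH r s v e es H u y -> I y -> Q y.

(** At a regular vertex only terms of exits of c remain, and these end in [H]. Otherwise f is the
    only edge from its source that ends outside [H], so the difference is v^H for v = s(f), and the
    nonzero polynomial forces it into [I]. *)
Lemma cycle_CK w c F f : qual_at H w c -> F != 0 -> I (ev w c F) -> f \in c ->
  Q (v (s f) - e f ** es f).
Proof.
move=> hq F0 IF fc; have [hc hH hx] := hq.
have hH' := ideal_edge_closed hL hI.
have [p [q [ec hr _]]] := cyc_rot hc fc.
have cc' : c =i f :: q ++ p by move=> g; rewrite ec -cat_cons !mem_cat orbC.
have {}IF := ev_same hI hc hr cc' IF.
have [G G0 {}IF] := ev_const hI hr F0 IF.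
have hfx g : s g = s f -> g != f -> I (v (r g)).
  move=> sg gf; apply: (hx f g fc sg); apply: contraNN gf => gc.
  by apply/eqP; apply: (cyc_inj hc).
have nr : ~ I (v (r f)).
  by have [f' /hH h <-] := cyc_succ hc fc.
have [[fin _]|nreg] := EM (regular s (s f)).
  have [l [ul hl]] := (fin_set_seq (fun g => s g = s f)).1 fin.
  have reg : regular s (s f) by split => //; exists f.
  rewrite (CK2 hL reg ul); last by move=> g; apply/idP/eqP => /hl.
  rewrite (bigD1_seq f) //=; last exact/hl.
  rewrite addrC addrK -big_filter; apply: (ideal_sum hQ) => g.
  rewrite mem_filter => /andP[gf /hl sg].
  by rewrite -(evr hL) -namulA; apply: (idealMl hQ); apply: (idealMr hQ); apply/hQH/hfx.
have sf g : g \in [:: f] -> s g = s f by rewrite inE => /eqP ->.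
have ecut : cut v e es (s f) [:: f] = v (s f) - e f ** es f by rewrite /cut big_seq1.
have mf g : g \in [:: f] <-> s g = s f /\ ~ I (v (r g)).
  rewrite inE; split=> [/eqP -> //|[sg ng]].
  by apply: contraT => /(hfx g sg).
rewrite -ecut; apply: (hQB (u := s f)).
- split; first by move=> fin; apply: nreg; split => //; exists f.
  split; first exact: hH.
  split; last by exists f.
  by apply/fin_set_seq; exists [:: f]; split => // g; rewrite -mf.
- by apply/is_vHE; exists [:: f].
apply: (ideal_scaleP hL hI G0).
(* The cut annihilates the first edge f of the rotated cycle, so between two cuts only the constant
   term of G survives. *)
have -> : G`_0 *: cut v e es (s f) [:: f] =
    cut v e es (s f) [:: f] ** ev (s f) (f :: q ++ p) G ** cut v e es (s f) [:: f].
  have [G1 ->] : exists G1, G = G1 * 'X + (G`_0)%:P.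
    exists (\poly_(i < (size G).-1) G`_i.+1); apply/polyP => i.
    rewrite coefD coefMX coefC coef_poly; case: i => [|i]; first by rewrite add0r.
    by rewrite addr0 /=; case: ltnP => // hi; rewrite nth_default //; case: (size G) hi.
  have := cut_e hL (isT : uniq [:: f]) sf (mem_head _ _).
  have := cut_v hL sf; have := cut_idem hL (isT : uniq [:: f]) sf.
  move: (cut _ _ _ _ _) => z zz zv zf.
  rewrite coefD coefMX coefC add0r evD evMX ev_C namulDr namulDl namulZr zv namulZl zz.
  by rewrite !namulA zf !namul0l add0r.
by apply: (idealMr hI); apply: (idealMl hI).
Qed.

End NoExit.

Section Commute.
Variables (H : E0 -> Prop) (Q : A -> Prop) (w : E0) (c : seq E1).
Hypotheses (hH : edge_closed r s H) (hQ : is_ideal Q) (hq : qual_at H w c).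
Hypothesis hQH : forall u, H u -> Q (v u).

Lemma path_CK u p : walk u p -> (forall f, f \in p -> Q (v (s f) - e f ** es f)) ->
  Q (v u - rpath u p ** gpath u p).
Proof.
elim: p u => [|f p IH] u /=; first by move=> _ _; rewrite (vv hL) subrr; apply: (ideal0 hQ).
case/andP=> /eqP <- hp hs.
have -> : v (s f) - e f ** rpath (r f) p ** (gpath (r f) p ** es f) =
    (v (s f) - e f ** es f) + e f ** (v (r f) - rpath (r f) p ** gpath (r f) p) ** es f.
  by rewrite namulBr namulBl (evr hL) addrA subrK !namulA.
apply: (idealD hQ); first by apply: hs; rewrite mem_head.
apply: (idealMr hQ); apply: (idealMl hQ); apply: IH => // g gp.
by apply: hs; rewrite in_cons gp orbT.
Qed.

(** Let y be a monomial p q^*. Either p ends in [H], or p follows c and q follows c'; then their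
    common end lies on both cycles, which forces them to have the same edges. *)
Lemma corner_diff w' c' F G y : qual_at H w' c' -> ~ c =i c' ->
  Q (ev w c F ** y ** ev w' c' G).
Proof.
move=> hq' cc'; have [hc hcH _] := hq; have [hc' hcH' _] := hq'.
have /and4P[_ wc /eqP rc _] := hc; have /and4P[_ wc' /eqP rc' _] := hc'.
move: y; apply: (mono_ind hL).
- by rewrite namul0r namul0l; apply: (ideal0 hQ).
- by move=> x y hx hy; rewrite namulDr namulDl; apply: (idealD hQ).
move=> k u p u' q hp hp' rpq; rewrite namulZr namulZl; apply: (idealZ hL _ hQ).
have [eu|nu] := eqVneq u w; last first.
  rewrite namulA -(evr_v hL wc) -(namulA _ (v w)) (rpath_l0 hL) // namul0r !namul0l.
  exact: (ideal0 hQ).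
have [eu'|nu'] := eqVneq u' w'; last first.
  rewrite -(ev_v hL wc') -!namulA (namulA (gpath u' q)) (gpath_r0 hL) //.
  by rewrite namul0l !namul0r; apply: (ideal0 hQ).
subst u u'; have [Hp|nHp] := EM (H (endpt w p)).
  apply: (idealMr hQ); apply: (idealMl hQ); apply: (idealMr hQ).
  by rewrite -(rpath_r hL); apply: (idealMl hQ); apply: hQH.
case: cc'; have [d _] : exists d : E1, True.
  by move/cyc_size: hc; case: (c) => // d *; exists d.
have sc := cyc_size hc; have sc' := cyc_size hc'.
have ep := qual_at_follow d hH hq hp nHp.
have nHq : ~ H (endpt w' q) by rewrite -rpq.
have eq := qual_at_follow d hH hq' hp' nHq.
apply: (qual_at_meet (f := nth d c (size p %% size c)) (f' := nth d c' (size q %% size c')) hq hc').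
- exact: hcH'.
- by rewrite mem_nth // ltn_mod.
- by rewrite mem_nth // ltn_mod.
have [_ <-] := cyc_per d (size p) hc; have [_ <-] := cyc_per d (size q) hc'.
by rewrite -ep -eq.
Qed.

Hypothesis hCK : forall f, f \in c -> Q (v (s f) - e f ** es f).

(** By [hCK], c c^* is [w] modulo [Q], so a monomial p q^* not already in [Q] acts between the two
    factors as a power of c or of c^*. Such a power can be moved to the left of F(c), which leaves a
    multiple of (F G)(c). *)
Lemma corner F G y : Q (ev w c (F * G)) -> Q (ev w c F ** y ** ev w c G).
Proof.
move=> hFG; have [hc hcH _] := hq; have /and4P[_ wc /eqP rc _] := hc.
have [d _] : exists d : E1, True.
  by move/cyc_size: hc; case: (c) => // d *; exists d.
have sc := cyc_size hc.
move: y; apply: (mono_ind hL).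
- by rewrite namul0r namul0l; apply: (ideal0 hQ).
- by move=> x y hx hy; rewrite namulDr namulDl; apply: (idealD hQ).
move=> k u p u' q hp hp' rpq; rewrite namulZr namulZl; apply: (idealZ hL _ hQ).
have [eu|nu] := eqVneq u w; last first.
  rewrite namulA -(evr_v hL wc) -(namulA _ (v w)) (rpath_l0 hL) // namul0r !namul0l.
  exact: (ideal0 hQ).
have [eu'|nu'] := eqVneq u' w; last first.
  rewrite -(ev_v hL wc G) -!namulA (namulA (gpath u' q)) (gpath_r0 hL) //.
  by rewrite namul0l !namul0r; apply: (ideal0 hQ).
subst u u'; have [Hp|nHp] := EM (H (endpt w p)).
  apply: (idealMr hQ); apply: (idealMl hQ); apply: (idealMr hQ).
  by rewrite -(rpath_r hL); apply: (idealMl hQ); apply: hQH.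
have ep := qual_at_follow d hH hq hp nHp.
have nHq : ~ H (endpt w q) by rewrite -rpq.
have eq := qual_at_follow d hH hq hp' nHq.
have emod : size p = size q %[mod size c].
  apply/eqP; rewrite -(nth_uniq d _ _ (cyc_uniq hc)) ?ltn_mod //; apply/eqP.
  apply: (cyc_inj hc); rewrite ?mem_nth ?ltn_mod //.
  have [_ <-] := cyc_per d (size p) hc; have [_ <-] := cyc_per d (size q) hc.
  by rewrite -ep -eq.
have CKper L : Q (v w - rpath w (per d c L) ** gpath w (per d c L)).
  apply: path_CK; first by case: (cyc_per d L hc).
  by move=> f /(per_mem sc); apply: hCK.
have pw n : cpow w c n = rpath w (per d c (n * size c)) by rewrite (cpow_per hL wc rc d).
have [le|/ltnW le] := leqP (size q) (size p).
- have [n hn] : exists n, size p = (n * size c + size q)%N.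
    have /dvdnP [n hn] : (size c %| size p - size q)%N by rewrite -eqn_mod_dvd // emod.
    by exists n; rewrite -hn subnK.
  have [wn rn] := closed_per d n wc rc.
  have -> : rpath w p = cpow w c n ** rpath w q.
    have := rpath_cat hL (u := w) (p := per d c (n * size c)) (q := q).
    by rewrite rn -pw => /(_ hp') ->; rewrite {1}eq -per_catM -hn -ep.
  have -> : ev w c F ** (cpow w c n ** rpath w q ** gpath w q) ** ev w c G =
      (ev w c F ** cpow w c n) ** (rpath w q ** gpath w q) ** ev w c G by rewrite !namulA.
  apply: (ideal_congr (b := v w) hQ).
    by apply/(ideal_subC _ _ hQ); rewrite eq.
  rewrite -(evXn r v e w c n) -!namulA (ev_v hL wc) -!(evM hL wc).
  by rewrite mulrCA (evM hL wc); apply: (idealMl hQ).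
- have [n hn] : exists n, size q = (n * size c + size p)%N.
    have /dvdnP [n hn] : (size c %| size q - size p)%N by rewrite -eqn_mod_dvd // emod.
    by exists n; rewrite -hn subnK.
  have [wn rn] := closed_per d n wc rc.
  pose gn := gpath w (per d c (n * size c)).
  have -> : gpath w q = gpath w p ** gn.
    have := gpath_cat hL (u := w) (p := per d c (n * size c)) (q := p).
    by rewrite rn => /(_ hp) ->; rewrite {1}ep -per_catM -hn -eq.
  have -> : ev w c F ** (rpath w p ** (gpath w p ** gn)) ** ev w c G =
      ev w c F ** (rpath w p ** gpath w p) ** (gn ** ev w c G) by rewrite !namulA.
  apply: (ideal_congr (b := v w) hQ); first by apply/(ideal_subC _ _ hQ); rewrite ep.
  rewrite (evr_v hL wc).
  have gv : gn ** cpow w c n = v w by rewrite pw (gpath_rpath hL) // rn.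
  (* Here F(c) = gn c^n F(c) = gn F(c) c^n, and c^n gn is [w] modulo [Q]. *)
  have -> : ev w c F ** (gn ** ev w c G) =
      gn ** ev w c F ** (cpow w c n ** gn) ** ev w c G.
    rewrite -{1}(ev_v hL wc F) -gv -(evXn r v e w c n) !namulA; congr (_ ** _ ** _).
    by rewrite -!namulA -!(evM hL wc) mulrC.
  apply: (ideal_congr (b := v w) hQ).
    by apply/(ideal_subC _ _ hQ); rewrite pw.
  rewrite -!namulA (ev_v hL wc) -(evM hL wc).
  exact: (idealMl hQ).
Qed.

End Commute.
End Corner.

(** * Semiprime ideals and factorizations *)

Section Poly.
Variable K : fieldType.
Implicit Types (p F G : {poly K}).

Lemma poly_pid (S : {poly K} -> Prop) : S 0 -> (forall F G, S F -> S G -> S (F - G)) ->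
  (forall F G, S F -> S (F * G)) -> exists p, forall F, S F <-> p %| F.
Proof.
move=> S0 SB SM; have [[G [SG G0]]|hn] := EM (exists F, S F /\ F != 0); last first.
  exists 0 => F; rewrite dvd0p; split=> [SF|/eqP -> //].
  by apply: contra_notT hn => F0; exists F.
pose P n := `[< exists F, [/\ S F, F != 0 & size F = n] >].
have exP : exists n, P n by exists (size G); apply/asboolP; exists G.
case: (ex_minnP exP) => n /asboolP [p [Sp p0 sp]] hmin.
exists p => F; split=> [SF|/dvdpP [q ->]]; last by rewrite mulrC; apply: SM.
apply: contraT => nd; have : P (size (F %% p)).
  apply/asboolP; exists (F %% p); split => //.
  have -> : F %% p = F - p * (F %/ p) by rewrite {2}(divp_eq F p) [_ * p]mulrC addrAC subrr add0r.
  by apply: SB => //; apply: SM.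
by move/hmin; rewrite -sp leqNgt ltn_modp p0.
Qed.

(* Zero and nonzero constants are allowed. *)
Definition radical p := forall F, p %| F * F -> p %| F.

Lemma radical1 : radical 1. Proof. by move=> F _; apply: dvd1p. Qed.

(** If p divides F^2 but not F, then gcd(p, F) is a proper divisor of p, and it is not constant
    since p would otherwise be coprime to F and divide F. So p splits into two factors of smaller
    size. *)
Lemma radical_factor p : p != 0 ->
  exists l : seq {poly K}, (forall q, q \in l -> radical q) /\ \prod_(q <- l) q = p.
Proof.
elim: {p}(size p) {-2}p (leqnn (size p)) => [|n IH] p sp p0.
  by move: p0; rewrite -size_poly_leq0 sp.
have [rp|nr] := EM (radical p).
  by exists [:: p]; rewrite big_seq1; split => // q; rewrite inE => /eqP ->.
have [F [pFF npF]] : exists F, p %| F * F /\ ~~ (p %| F).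
  apply: contrapT => hn; apply: nr => F pFF; apply: contraT => npF.
  by case: hn; exists F.
have dp := dvdp_gcdl p F; set d := gcdp p F in dp.
have d0 : d != 0 by apply: contraNneq p0 => d0; rewrite d0 dvd0p in dp.
have lt1 : (size d < size p)%N.
  rewrite ltn_neqAle (dvdp_leq p0 dp) andbT; apply: contraNneq npF => sd.
  have /eqp_dvdl -> : p %= d by rewrite eqp_sym -(dvdp_size_eqp dp) sd.
  exact: dvdp_gcdr.
have lt2 : (1 < size d)%N.
  rewrite ltnNge; apply: contra npF => sd.
  have cp : coprimep p F by rewrite /coprimep eqn_leq sd lt0n size_poly_eq0.
  by rewrite -(Gauss_dvdpl _ cp).
have ep : p %/ d * d = p by rewrite divpK.
have q0 : p %/ d != 0 by apply: contraNneq p0 => q0; rewrite -ep q0 mul0r.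
have [||l1 [h1 e1]] := IH d => //; first by rewrite -ltnS (leq_trans lt1).
have [||l2 [h2 e2]] := IH (p %/ d) => //.
  by rewrite -ltnS (leq_trans _ sp) // size_divp // ltn_subrL -subn1 subn_gt0 lt2 size_poly_gt0.
exists (l2 ++ l1); rewrite big_cat /= e1 e2; split => // q.
by rewrite mem_cat => /orP[/h2|/h1].
Qed.

(** Over every field this is nonconstant with nonzero constant term, so all its powers can be moduli
    of Chen modules. *)
Definition theta : {poly K} := 'X - 1%:P.
Lemma theta_coef0 n : (theta ^+ n)`_0 != 0.
Proof.
by rewrite -horner_coef0 horner_exp hornerXsubC sub0r expf_neq0 // oppr_eq0 oner_eq0.
Qed.
Lemma theta_size n : size (theta ^+ n) = n.+1.
Proof. exact: size_exp_XsubC. Qed.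
Lemma theta_neq0 n : theta ^+ n != 0.
Proof. by rewrite -size_poly_eq0 theta_size. Qed.

End Poly.

Section Products.
Variables (K : fieldType) (A : nalg K).
Implicit Types (I J : A -> Prop).

(** By the first hypothesis the full algebra is neutral for products, so factors equal to it are
    dropped; as [I] is proper, some factor remains. *)
Lemma prod_of_semiprimes_or_full (Js : seq (A -> Prop)) I :
  (forall I, is_ideal I -> seteq (iprod I (fun=> True)) I /\ seteq (iprod (fun=> True) I) I) ->
  is_ideal I -> Defs.proper I ->
  (forall J, List.In J Js -> semiprime J \/ seteq J (fun=> True)) ->
  seteq I (foldl (@iprod K A) (fun=> True) Js) -> prod_semiprimes I.
Proof.
move=> hfull hI [x nx].
set full : A -> Prop := fun=> True => hJs eI.
have : seteq (foldl (@iprod K A) full Js) full \/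
    exists J (Js' : seq (A -> Prop)), [/\ semiprime J,
      forall J', List.In J' Js' -> semiprime J' &
      seteq (foldl (@iprod K A) full Js) (foldl (@iprod K A) J Js')].
  elim/last_ind: Js hJs {eI} => [|Js J IH] hJs; first by left.
  have hJ : semiprime J \/ seteq J full.
    by apply: hJs; rewrite -cats1; apply: List.in_or_app; right; left.
  have hIH J' : List.In J' Js -> semiprime J' \/ seteq J' full.
    by move=> h; apply: hJs; rewrite -cats1; apply: List.in_or_app; left.
  rewrite -cats1 foldl_cat /=.
  case: (IH hIH) => [e1|[J0 [Js0 [s1 s2 e1]]]]; case: hJ => [sJ|eJ].
  - right; exists J, [::]; split => //.
    apply: seteq_trans (seteq_iprod e1 (fun x => iff_refl _)) _.
    by case: (hfull J); first by case: sJ.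
  - left; apply: seteq_trans (seteq_iprod e1 eJ) _.
    by case: (hfull full) => //; split.
  - right; exists J0, (rcons Js0 J); split => //.
      move=> J'; rewrite -cats1 => h; case: (List.in_app_or _ _ _ h) => [/s2 //|[<-|[]]] //.
    rewrite -cats1 foldl_cat /=; exact: seteq_iprod.
  - right; exists J0, Js0; split => //.
    apply: seteq_trans (seteq_iprod e1 eJ) _.
    by case: (hfull (foldl (@iprod K A) J0 Js0)) => //; apply: foldl_iprod_ideal; case: s1.
case=> [e1|[J [Js' [s1 s2 e1]]]]; first by case: nx; apply/eI/e1.
by exists J, Js'; split => //; split => //; apply: seteq_trans e1.
Qed.

End Products.

(** * Separation of cycles and a criterion for semiprime ideals *)

Section Tools.
Variables (K : fieldType) (E0 E1 : eqType) (r s : E1 -> E0).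
Variables (A : nalg K) (v : E0 -> A) (e es : E1 -> A).
Hypothesis hL : is_LPA r s v e es.
Implicit Types (u w : E0) (f : E1) (p q c : seq E1) (x y z : A) (F G : {poly K}).
Notation endpt := (endpt r).
Notation cyc := (cyc r s).
Notation qual_at := (qual_at r s).
Notation ev := (ev r v e).
Notation gr := (gr r s v e es).

Lemma iprod_full (I : A -> Prop) : is_ideal I ->
  seteq (iprod I (fun=> True)) I /\ seteq (iprod (fun=> True) I) I.
Proof.
move=> hI; have ht : is_ideal (fun _ : A => True) by split.
split=> x; split=> h.
- exact: (iprod_subl hI h).
- by have [U [_ [<- _]]] := local_unit hL x; apply: iprodM.
- exact: (iprod_subr hI h).
- by have [U [<- _]] := local_unit hL x; apply: iprodM.
Qed.

Lemma cyc_edge_closed P w c f : edge_closed r s P -> cyc w c -> f \in c -> P (s f) -> P w.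
Proof.
move=> hP hc fc Pf; have [p [q [ec hr rp]]] := cyc_rot hc fc.
have /and4P[_ wc /eqP rc _] := hc.
have -> : w = endpt (s f) (f :: q) by rewrite -{1}rc ec endpt_cat rp.
apply: (edge_closed_endpt hP _ Pf).
by case/and4P: hr => _; rewrite -cat_cons walk_cat => /andP[].
Qed.

Lemma chen_ideal H w0 c0 (g : {poly K}) : edge_closed r s H -> qual_at H w0 c0 -> g`_0 != 0 ->
  exists J : A -> Prop, [/\ is_ideal J,
    forall P u, edge_closed r s P -> (forall f, f \in c0 -> ~ P (s f)) -> P u -> J (v u),
    forall P u y, edge_closed r s P -> (forall f, f \in c0 -> ~ P (s f)) ->
      is_vH r s v e es P u y -> J y,
    forall F, J (ev w0 c0 F) <-> g %| F &
    (forall P w c F, edge_closed r s P -> (forall f, f \in c0 -> ~ P (s f)) ->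
       qual_at P w c -> ~ c =i c0 -> J (ev w c F)) /\
    ((1 < size g)%N -> forall f, f \in c0 -> ~ J (v (s f)))].
Proof.
move=> hH hc0 g0; have [J [hJ h1 h2 h3]] := chen hL hH hc0 g0.
have [cc0 _ _] := hc0.
exists J; split => //; split.
  move=> P w c F hP hPc hq ncc; have [hc _ hx] := hq.
  have /and4P[_ wc _ _] := hc.
  rewrite -(ev_v hL wc); apply: (idealMr hJ).
  (* This set is closed under edges because exits of c end in [P], and it misses c0 because
     otherwise the two cycles would share a vertex and coincide. *)
  apply: (h1 (fun u => P u \/ exists2 f, f \in c & s f = u)).
  - move=> f [/hP|[f' fc sf]]; first by left.
    case: (boolP (f \in c)) => fc'; last by left; apply: hx fc _ fc'.
    by right; have [f2 f2c <-] := cyc_succ hc fc'; exists f2.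
  - move=> f fc0 [|[f' fc sf]]; first exact: hPc.
    by case: ncc; apply: (qual_at_meet hq cc0 hPc fc fc0).
  - right; case: (c) hc => [|f c'] hc; first by case/cyc_size: hc.
    by exists f; rewrite ?mem_head // (cyc_head f hc).
move=> sg f fc Jf; have Jw := cyc_edge_closed (ideal_edge_closed hL hJ) cc0 fc Jf.
have : J (ev w0 c0 1) by rewrite -polyC1 ev_C scale1r.
move/h3 => /dvdp_leq; rewrite oner_eq0 size_poly1 => /(_ isT).
by rewrite leqNgt sg.
Qed.

Lemma gr_sub (I : A -> Prop) : is_ideal I -> Defs.subset (gr I) I.
Proof.
move=> hI x; apply; first exact: hI.
by move=> y [[u [Iu ->]]|[u [_ [_ Iy]]]].
Qed.

Lemma ideal_saturated (I : A -> Prop) : is_ideal I -> saturated r s (fun u => I (v u)).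
Proof.
move=> hI u hu h; have [/fin_set_seq [l [ul hl]] _] := hu.
rewrite (CK2 hL hu ul); last by move=> f; apply/idP/eqP => /hl.
apply: (ideal_sum hI) => f /hl sf; rewrite -(evr hL) -namulA.
by apply: (idealMl hI); apply: (idealMr hI); apply: h.
Qed.

(** If B has square in [J], so has B' = B + J. The vertices and elements v^H in B' are idempotent,
    hence in [J], and F(c) in B' has square in [J]. Thus [structure_sub] gives the inclusion of B'
    in [J]. *)
Lemma semiprime_criterion (J : A -> Prop) : is_ideal J -> Defs.proper J ->
  (forall w c F, qual_at (fun u => J (v u)) w c -> J (ev w c (F * F)) -> J (ev w c F)) ->
  semiprime J.
Proof.
move=> hJ pJ hrad; split => //; split => // B hB BB.
pose B' x := exists b j, [/\ B b, J j & x = b + j].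
have JB' : Defs.subset J B'.
  by move=> x Jx; exists 0, x; rewrite add0r; split => //; apply: (ideal0 hB).
have hB' : is_ideal B'.
  split; first exact/JB'/(ideal0 hJ).
  split=> [x y [b [j [Bb Jj ->]]] [b' [j' [Bb' Jj' ->]]]|a x [b [j [Bb Jj ->]]]].
    exists (b - b'), (j - j'); split; [exact: idealB | exact: idealB |].
    by rewrite opprD addrACA.
  split; [exists (a ** b), (a ** j) | exists (b ** a), (j ** a)];
    rewrite ?namulDr ?namulDl; split => //;
    by [apply: (idealMl hB) | apply: (idealMl hJ) | apply: (idealMr hB) | apply: (idealMr hJ)].
have BBJ x y : B' x -> B' y -> J (x ** y).
  move=> [b [j [Bb Jj ->]]] [b' [j' [Bb' Jj' ->]]].
  rewrite namulDr !namulDl; apply: (idealD hJ); apply: (idealD hJ);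
    try by [apply: (idealMl hJ) | apply: (idealMr hJ)].
  by apply: BB; apply: iprodM.
have JH u : B' (v u) -> J (v u) by move=> Bu; rewrite -(vv hL); apply: BBJ.
have eH : (fun u => B' (v u)) = (fun u => J (v u)).
  by apply/funext => u; apply/propext; split; [apply: JH | apply: JB'].
suff sub : Defs.subset B' J.
  by move=> x Bx; apply: sub; exists x, 0; rewrite addr0; split => //; apply: (ideal0 hJ).
apply: (structure_sub hL) => //.
- by move=> u y _ /(is_vH_idem hL) yy By; rewrite -yy; apply: BBJ.
- move=> w c F hq BF; apply: hrad; first by rewrite -eH.
  have [hc _ _] := hq; have /and4P[_ wc /eqP rc _] := hc.
  by rewrite (evM hL wc); apply: BBJ.
Qed.

End Tools.

(** * The equivalences *)

Section Main.
Variables (K : fieldType) (E0 E1 : eqType) (r s : E1 -> E0).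
Variables (A : nalg K) (v : E0 -> A) (e es : E1 -> A).
Hypothesis hL : is_LPA r s v e es.
Implicit Types (u w : E0) (f : E1) (p q c : seq E1) (x y z : A) (F G : {poly K}).
Notation walk := (walk r s).
Notation qual_at := (qual_at r s).
Notation ev := (ev r v e).
Notation theta := (theta K).

Lemma cond3P : cond3 r s <-> forall H, edge_closed r s H -> saturated r s H ->
  exists cs : seq (seq E1), forall w c, qual_at H w c -> exists2 c', c' \in cs & c =i c'.
Proof.
split=> h H hH hS.
  have [cs hcs] := h H ((hereditaryE r s H).2 hH) hS; exists cs => w c hq.
  have [|c' [/In_mem c'cs /same_cycleE cc']] := hcs c; last by exists c'.
  by apply/qual_cycleE => //; exists w.
have hH' := (hereditaryE r s H).1 hH.
have [cs hcs] := h H hH' hS; exists cs => c /(qual_cycleE _ hH') [w /hcs [c' c'cs cc']].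
by exists c'; split; [apply/In_mem | apply/same_cycleE].
Qed.

Lemma not_cond3 : ~ cond3 r s -> exists H, edge_closed r s H /\
  forall cs : seq (seq E1), exists w c, qual_at H w c /\ forall c', c' \in cs -> ~ c =i c'.
Proof.
move=> n3; apply: contrapT => hn; apply/n3/cond3P => H hH hS; apply: contrapT => hcs.
apply: hn; exists H; split => // cs; apply: contrapT => hn; apply: hcs; exists cs => w c hq.
apply: contrapT => hc; apply: hn; exists w, c; split => // c' c'cs cc'.
by apply: hc; exists c'.
Qed.

Lemma dvd_theta_exp m n : theta ^+ m %| theta ^+ n -> (m <= n)%N.
Proof. by move/(dvdp_leq (theta_neq0 K n)); rewrite !theta_size. Qed.

Lemma cond2_cond3 : cond2 r s v e es -> cond3 r s.
Proof.
move=> h2; apply: contrapT => /not_cond3 [H [hH hcs]].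
pose T := {t : E0 * seq E1 | qual_at H t.1 t.2}.
pose G (t : T) := ev (sval t).1 (sval t).2 theta.
pose S y := exists u, H u /\ y = v u.
pose I := gen (fun y => S y \/ exists t, y = G t).
have hI : is_ideal I by apply: gen_ideal.
have [xs [hxs eI]] := h2 I hI.
have [l hl] := gen_finite_seq hxs.
have [w0 [c0 [hq0 hn]]] := hcs [seq (sval t).2 | t : T <- l].
have [cc0 hc0 _] := hq0.
(* The Chen ideal of c0 for X - 1 contains I and no vertex of c0. Hence I has no vertex on c0, and
   gr(I) lies in every Chen ideal of c0. *)
have hI0 f : f \in c0 -> ~ I (v (s f)).
  have [J [hJ J1 _ J3 [J4 J5]]] := chen_ideal hL hH hq0 (theta_coef0 K 1).
  have IJ : Defs.subset I J.
    apply: gen_min => // y [[u [Hu ->]]|[[[w c] /= hq] ->]]; first exact: (J1 H).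
    have [cc|ncc] := EM (c =i c0); last exact: (J4 H).
    have [hc _ _] := hq; apply: (ev_same hL hJ cc0 hc) => [g|]; first by rewrite cc.
    by apply/J3; rewrite expr1.
  by move=> fc /IJ; apply: J5 => //; rewrite theta_size.
(* For the square of X - 1, the Chen ideal contains gr(I) and the finitely many generators used, as
   these belong to cycles other than c0; but it does not contain (X - 1)(c0). *)
have [J [hJ J1 J2 J3 [J4 _]]] := chen_ideal hL hH hq0 (theta_coef0 K 2).
have hIH := ideal_edge_closed hL hI.
have IJ : Defs.subset I J.
  move=> x /eI; apply; first exact: hJ.
  move=> y [|yxs].
    apply; first exact: hJ.
    move=> z [[u [Iu ->]]|[u [_ [hz _]]]]; first exact: (J1 (fun u => I (v u))).
    exact: (J2 _ _ _ hIH hI0 hz).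
  apply: (hl y yxs) => // z [[u [Hu ->]]|[[[w c] hq] tl ->]]; first exact: (J1 H).
  apply: (J4 H) => // cc; apply: (hn c) => [|g]; last by rewrite cc.
  by apply/In_mem/List.in_map_iff; exists (exist _ (w, c) hq).
have : J (ev w0 c0 theta).
  by apply: (IJ); apply: gen_sub; right; exists (exist _ (w0, c0) hq0).
by move/J3; rewrite -{2}(expr1 theta) => /dvd_theta_exp.
Qed.

(** If c has no vertex in [J], it is qualified for the vertices of [J], and [corner] puts F(c) A
    F(c) into [J]; so the ideal generated by F(c) has square in [J]. *)
Lemma semiprime_ev (J : A -> Prop) H w c F : semiprime J -> edge_closed r s H ->
  (forall u, H u -> J (v u)) -> qual_at H w c -> F != 0 -> J (ev w c (F * F)) -> J (ev w c F).
Proof.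
move=> [hJ [_ sJ]] hH HJ [hc hcH hx] F0 JFF.
have hJH := ideal_edge_closed hL hJ.
have /and4P[_ wc /eqP rc _] := hc.
have [[f [fc Jf]]|nJ] := EM (exists f, f \in c /\ J (v (s f))).
  rewrite -(ev_v hL wc); apply: (idealMr hJ).
  exact: (cyc_edge_closed hJH hc fc Jf).
have hq : qual_at (fun u => J (v u)) w c.
  split => // [f fc Jf|f g fc sg gc]; first by apply: nJ; exists f.
  exact/HJ/(hx f g).
have FF0 : F * F != 0 by rewrite mulf_neq0.
have CK f := cycle_CK hL hJ hJ (fun u h => h) (fun u y _ _ h => h) hq FF0 JFF (f := f).
have cor y : J (ev w c F ** y ** ev w c F).
  exact: (corner hL hJH hJ hq (fun u h => h) CK).
apply: (sJ (gen (fun y => y = ev w c F))); first exact: gen_ideal.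
  apply: iprod_genS => // [x y -> ->|x y z -> -> //].
  by rewrite -(evM hL wc).
exact: gen_sub.
Qed.

Lemma foldl_iprod_ev (I : A -> Prop) Js w c F n : walk w c ->
  I (ev w c (F ^+ n)) -> (forall J, List.In J Js -> J (ev w c F)) ->
  foldl (@iprod K A) I Js (ev w c (F ^+ (n + size Js))).
Proof.
move=> wc; elim: Js I n => [|J Js IH] I n In hJs; first by rewrite addn0.
rewrite /= addnS -addSn; apply: IH => [|J' h]; last by apply: hJs; right.
by rewrite exprSr (evM hL wc); apply: iprodM => //; apply: hJs; left.
Qed.

Lemma cond1_cond3 : cond1 A -> cond3 r s.
Proof.
move=> h1; apply: contrapT => /not_cond3 [H [hH hcs]].
pose T := {t : E0 * seq E1 | qual_at H t.1 t.2}.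
have /choice [pick hpick] : forall cs : seq (seq E1), exists t : T,
    forall c', c' \in cs -> ~ (sval t).2 =i c'.
  by move=> cs; have [w [c [hq hn]]] := hcs cs; exists (exist _ (w, c) hq).
(* Picking each cycle off the list of its predecessors gives infinitely many pairwise inequivalent
   qualified cycles. *)
pose L n := iter n (fun cs => (sval (pick cs)).2 :: cs) [::].
pose t n := sval (pick (L n)).
have hq n : qual_at H (t n).1 (t n).2 by exact: (svalP (pick (L n))).
have L_le i n : (i < n)%N -> (t i).2 \in L n.
  elim: n => // n IH; rewrite ltnS leq_eqVlt => /orP[/eqP ->|/IH h].
    exact: mem_head.
  by rewrite /= in_cons h orbT.
have dist i j : i != j -> ~ (t i).2 =i (t j).2.
  case: ltngtP => // [/L_le h _ cc|/L_le h _]; last exact: hpick.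
  by apply: (hpick _ _ h) => f; rewrite -cc.
pose G n := ev (t n).1 (t n).2 (theta ^+ (2 ^ n)).
pose I := gen (fun y => (exists u, H u /\ y = v u) \/ exists n, y = G n).
have hI : is_ideal I by apply: gen_ideal.
(* The bound on m makes [theta ^+ m] divide the power used in [G n], so that the Chen ideal contains
   all of I. *)
have chenI n m : (m <= 2 ^ n)%N -> exists J : A -> Prop,
   [/\ is_ideal J, Defs.subset I J, forall F, J (ev (t n).1 (t n).2 F) <-> theta ^+ m %| F &
       (0 < m)%N -> forall f, f \in (t n).2 -> ~ J (v (s f))].
  move=> hm; have [J [hJ J1 _ J3 [J4 J5]]] := chen_ideal hL hH (hq n) (theta_coef0 K m).
  have [_ hcn _] := hq n.
  exists J; split => //; last by move=> m0; apply: J5; rewrite theta_size ltnS.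
  apply: gen_min => // y [[u [Hu ->]]|[i ->]]; first exact: (J1 H).
  have [->|ni] := eqVneq i n; first by apply/J3; rewrite dvdp_exp2l.
  by apply: (J4 H) => //; apply: dist.
have pI : Defs.proper I.
  have [J [_ IJ _ J5]] := chenI 0 1%N isT.
  have [hc _ _] := hq 0; case E : (t 0).2 hc => [|f c'] hc; first by case/cyc_size: hc.
  by exists (v (s f)) => /IJ; apply: J5 => //; rewrite E mem_head.
have [J0 [Js [s0 [hs eI]]]] := h1 I hI pI.
have sub J : J = J0 \/ List.In J Js -> Defs.subset I J.
  move=> hJ x /eI; case: hJ => [->|hJ]; first by apply: foldl_iprod_sub0; case: s0.
  by apply: (foldl_iprod_sub _ hJ) => J' /hs [].
have key J n : J = J0 \/ List.In J Js -> J (ev (t n).1 (t n).2 theta).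
  move=> hJ; have sJ : semiprime J by case: hJ => [->|/hs].
  have IJ := sub J hJ.
  suff red i : J (ev (t n).1 (t n).2 (theta ^+ (2 ^ i))) -> J (ev (t n).1 (t n).2 theta).
    by apply: (red n); apply: (IJ); apply: gen_sub; right; exists n.
  elim: i => [|i IH]; first by rewrite expn0 expr1.
  rewrite expnSr muln2 -addnn exprD => h; apply: IH.
  apply: (semiprime_ev sJ hH _ (hq n) (theta_neq0 K _) h).
  by move=> u Hu; apply: (IJ); apply: gen_sub; left; exists u.
(* This is the number of factors. Each contains theta at cycle number n, so I contains theta^n
   there; the Chen ideal for theta^(2^n) would give 2^n <= n. *)
set n := (size Js).+1.
have In : I (ev (t n).1 (t n).2 (theta ^+ n)).
  apply/eI; rewrite /n -add1n; apply: foldl_iprod_ev.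
  - by case: (hq (1 + size Js)%N) => /and4P[].
  - by rewrite expr1; apply: key; left.
  - by move=> J hJ; apply: key; right.
have [J [_ IJ J3 _]] := chenI n _ (leqnn _).
by move/IJ/J3/dvd_theta_exp: In; rewrite leqNgt ltn_expl.
Qed.

End Main.

(** * From finitely many qualified cycles to (1) and (2) *)

Section Converse.
Variables (K : fieldType) (E0 E1 : eqType) (r s : E1 -> E0).
Variables (A : nalg K) (v : E0 -> A) (e es : E1 -> A).
Hypothesis hL : is_LPA r s v e es.
Implicit Types (u w : E0) (f : E1) (c : seq E1) (x y z : A) (F G : {poly K}).
Notation cyc := (cyc r s).
Notation qual_at := (qual_at r s).
Notation ev := (ev r v e).
Notation gr := (gr r s v e es).
Notation theta := (theta K).

Section Ideal.
Variable I : A -> Prop.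
Hypothesis hI : is_ideal I.
Notation H := (fun u => I (v u)).

Lemma cycle_poly : exists p : E0 -> seq E1 -> {poly K},
  (forall w c, cyc w c -> forall F, I (ev w c F) <-> p w c %| F) /\
  (forall w w' c c', cyc w c -> cyc w' c' -> c =i c' -> p w c = p w' c').
Proof.
(* The generator is chosen as a function of the set of polynomials alone, so cycles with the same
   edges get equal and not merely associated generators. *)
have /choice [gen_of hgen] : forall S : {poly K} -> Prop, exists p : {poly K},
    [/\ S 0, (forall F G, S F -> S G -> S (F - G)) & (forall F G, S F -> S (F * G))] ->
    forall F, S F <-> p %| F.
  move=> S; have [[S0 SB SM]|hn] := EM [/\ S 0, (forall F G, S F -> S G -> S (F - G)) &
      (forall F G, S F -> S (F * G))]; last by exists 0.
  by have [p hp] := poly_pid S0 SB SM; exists p.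
exists (fun w c => gen_of (fun F => I (ev w c F))); split.
  move=> w c hc; have /and4P[_ wc _ _] := hc; apply: hgen; split.
  - by rewrite ev0; apply: (ideal0 hI).
  - by move=> F G hF hG; rewrite evB; apply: (idealB hI).
  - by move=> F G hF; rewrite (evM hL wc); apply: (idealMr hI).
move=> w w' c c' hc hc' cc'; congr gen_of; apply/funext => F; apply/propext; split.
  exact: (ev_same hL hI hc hc' cc').
by apply: (ev_same hL hI hc' hc) => f; rewrite cc'.
Qed.

Variable p : E0 -> seq E1 -> {poly K}.
Hypothesis hp : forall w c, cyc w c -> forall F, I (ev w c F) <-> p w c %| F.

Lemma cycle_poly_coef0 w c : cyc w c -> p w c != 0 -> (p w c)`_0 != 0.
Proof.
move=> hc p0; apply/negP => /eqP c0; have /and4P[_ wc /eqP rc _] := hc.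
have [F eF] : exists F, p w c = F * 'X.
  have : root (p w c) 0 by rewrite rootE horner_coef0 c0.
  by rewrite -dvdp_XsubCl subr0 => /dvdpP [F ->]; exists F.
have F0 : F != 0 by apply: contraNneq p0 => F0; rewrite eF F0 mul0r.
have IF : I (ev w c F).
  have -> : ev w c F = gpath r v es w c ** ev w c (F * 'X).
    by rewrite evMX namulA (gpath_rpath hL) // rc (ev_v hL).
  by apply: (idealMl hI); apply/(hp hc); rewrite eF.
by have /(dvdp_leq F0) := (hp hc F).1 IF; rewrite eF size_mulX // ltnn.
Qed.

Definition cycle_ideal (a : E0 -> seq E1 -> {poly K}) :=
  gen (fun y => gr I y \/ exists w c, qual_at H w c /\ y = ev w c (a w c)).

Lemma cycle_ideal_ideal a : is_ideal (cycle_ideal a). Proof. exact: gen_ideal. Qed.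
Lemma gr_cycle_ideal a : Defs.subset (gr I) (cycle_ideal a).
Proof. by move=> x h; apply: gen_sub; left. Qed.
Lemma ev_cycle_ideal a w c : qual_at H w c -> cycle_ideal a (ev w c (a w c)).
Proof. by move=> hq; apply: gen_sub; right; exists w, c. Qed.
Lemma gr_v u : I (v u) -> gr I (v u).
Proof. by move=> Iu; apply: gen_sub; left; exists u. Qed.
Lemma gr_vH u y : BH r s H u -> is_vH r s v e es H u y -> I y -> gr I y.
Proof. by move=> hu hy Iy; apply: gen_sub; right; exists u. Qed.

Lemma cycle_ideal_sub a (J : A -> Prop) : is_ideal J ->
  (forall u, I (v u) -> J (v u)) ->
  (forall u y, BH r s H u -> is_vH r s v e es H u y -> I y -> J y) ->
  (forall w c, qual_at H w c -> J (ev w c (a w c))) ->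
  Defs.subset (cycle_ideal a) J.
Proof.
move=> hJ h1 h2 h3; apply: gen_min => // y [|[w [c [hq ->]]]]; last exact: h3.
apply; first exact: hJ.
by move=> z [[u [Iu ->]]|[u [hu [hz Iz]]]]; [apply: h1 | apply: (h2 u)].
Qed.

Lemma cycle_idealP a : (forall w c, qual_at H w c -> p w c %| a w c) ->
  Defs.subset (cycle_ideal a) I.
Proof.
move=> ha; apply: cycle_ideal_sub => // w c hq; have [hc _ _] := hq.
by apply/(hp hc)/ha.
Qed.

Lemma sub_cycle_ideal (J : A -> Prop) : is_ideal J -> Defs.subset J I ->
  (forall u, I (v u) -> J (v u)) ->
  (forall u y, BH r s H u -> is_vH r s v e es H u y -> I y -> J y) ->
  (forall w c, qual_at H w c -> J (ev w c (p w c))) -> Defs.subset I J.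
Proof.
move=> hJ JI h1 h2 h3; apply: (structure_sub hL) => // w c F hq.
have [hc _ _] := hq; have /and4P[_ wc _ _] := hc.
move/(hp hc)/dvdpP => [G ->]; rewrite (evM hL wc); apply: (idealMl hJ); exact: h3.
Qed.

(** Inequivalent cycles contribute nothing by [corner_diff], equivalent ones are treated by
    [corner]. The latter needs c c^* = w modulo the target, which [cycle_CK] draws from a nonzero
    [p w c]; where [a] is 0 the product vanishes. *)
Lemma cycle_idealM a b :
  (forall w c, qual_at H w c -> (a w c = 0) \/ (p w c != 0)) ->
  (forall w w' c c', qual_at H w c -> qual_at H w' c' -> c =i c' -> b w c = b w' c') ->
  Defs.subset (iprod (cycle_ideal a) (cycle_ideal b))
    (cycle_ideal (fun w c => a w c * b w c)).
Proof.
move=> ha hb; have hH := ideal_edge_closed hL hI.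
pose Q := cycle_ideal (fun w c => a w c * b w c).
rewrite -/Q; have hQ : is_ideal Q by apply: cycle_ideal_ideal.
have QH u : I (v u) -> Q (v u) by move/gr_v; apply: gr_cycle_ideal.
have QB u y : BH r s H u -> is_vH r s v e es H u y -> I y -> Q y.
  by move=> hu hy Iy; apply: gr_cycle_ideal; apply: gr_vH hu hy Iy.
have key x z y : gr I x \/ (exists w c, qual_at H w c /\ x = ev w c (a w c)) ->
    gr I y \/ (exists w c, qual_at H w c /\ y = ev w c (b w c)) -> Q (x ** z ** y).
  move=> [gx|[w [c [hq ->]]]].
    by move=> _; do 2!apply: (idealMr hQ); apply: gr_cycle_ideal.
  move=> [gy|[w' [c' [hq' ->]]]]; first by apply: (idealMl hQ); apply: gr_cycle_ideal.
  have [cc'|] := EM (c =i c'); last exact: (corner_diff hL hH hQ hq QH _ _ _ hq').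
  have [a0|p0] := ha _ _ hq; first by rewrite a0 ev0 !namul0l; apply: (ideal0 hQ).
  have [hc _ _] := hq; have [hc' _ _] := hq'.
  have [p1 [q1 [ec ec' rp]]] := cyc_same hc hc' cc'.
  have /and4P[_ wc /eqP rc _] := hc.
  (* The second value is carried to the base vertex of the first. *)
  have -> : ev w' c' (b w' c') =
      gpath r v es w p1 ** ev w c (b w c) ** rpath r v e w p1.
    by rewrite (hb _ _ _ _ hq hq' cc') ec' -rp ec; apply: (ev_rot hL); rewrite -ec.
  have -> : forall x1 x2 x3 x4 : A,
      x1 ** z ** (x2 ** x3 ** x4) = x1 ** (z ** x2) ** x3 ** x4.
    by move=> x1 x2 x3 x4; rewrite !namulA.
  apply: (idealMr hQ); apply: (corner hL hH hQ hq QH) => [f fc|].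
    apply: (cycle_CK hL hI hQ QH QB hq p0 _ fc).
    exact/(hp hc).
  exact: (@ev_cycle_ideal (fun w c => a w c * b w c)).
apply: iprod_genS => // x y Sx Sy; last by move=> Sx' Sy'; apply: key.
case: (Sx) => [gx|[w [c [hq ex]]]].
  by apply: (idealMr hQ); apply: gr_cycle_ideal.
have [hc _ _] := hq; have /and4P[_ wc _ _] := hc.
(* The base vertex is inserted as a middle factor. *)
by rewrite ex -(evr_v hL wc) -ex; apply: key.
Qed.

Lemma cycle_ideal_radical a :
  (forall w c, qual_at H w c ->
     a w c = 0 \/ [/\ p w c != 0, a w c %| p w c & radical (a w c)]) ->
  (forall w w' c c', qual_at H w c -> qual_at H w' c' -> c =i c' -> a w c = a w' c') ->
  forall w c F, qual_at (fun u => cycle_ideal a (v u)) w c ->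
    cycle_ideal a (ev w c (F * F)) -> cycle_ideal a (ev w c F).
Proof.
move=> ha hac w0 c0 F hq0 JFF; have [hc0 hJ0 _] := hq0.
have hH := ideal_edge_closed hL hI.
have hJ := cycle_ideal_ideal a; have hHJ := ideal_edge_closed hL hJ.
have hH0 f : f \in c0 -> ~ I (v (s f)).
  by move=> fc If; apply: (hJ0 f fc); apply: gr_cycle_ideal; apply: gr_v.
(* Under these conditions the Chen ideal of c0 for g contains all generators of [cycle_ideal a],
   hence also F^2 at c0. *)
have sub (g : {poly K}) : g`_0 != 0 -> (forall w c, qual_at H w c -> c =i c0 -> g %| a w c) -> g %| F * F.
  move=> g0 hg; have [C [hC C1 C2 C3 [C4 _]]] := chen_ideal hL hHJ hq0 g0.
  apply/C3; apply: (cycle_ideal_sub hC) JFF => [u|u y _ hy _|w c hq].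
  - exact: (C1 H).
  - exact: C2 hH hH0 hy.
  have [cc|ncc] := EM (c =i c0); last exact: (C4 H).
  have [hc _ _] := hq; apply: (ev_same hL hC hc0 hc) => [f|]; first by rewrite cc.
  by apply/C3; apply: hg.
have [F0|F0] := eqVneq F 0; first by rewrite F0 ev0; apply: (ideal0 hJ).
(* This includes the case that c0 is qualified only for the larger vertex set of [cycle_ideal a].
   Every power of theta then divides F^2, which is impossible for nonzero F. *)
have [az|] := EM (forall w c, qual_at H w c -> c =i c0 -> a w c = 0).
  have FF0 : F * F != 0 by rewrite mulf_neq0.
  have : theta ^+ size (F * F) %| F * F.
    by apply: sub (theta_coef0 K _) _ => w c hq cc; rewrite az ?dvdp0.
  by move/(dvdp_leq FF0); rewrite theta_size ltnn.
move=> nz; have [w [c [hq cc az]]] : exists w c, [/\ qual_at H w c, c =i c0 & a w c != 0].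
  apply: contrapT => hn; apply: nz => w c hq cc; apply/eqP/negPn/negP => az.
  by apply: hn; exists w, c.
have [az'|[p0 ap rad]] := ha w c hq; first by rewrite az' eqxx in az.
have [hc _ _] := hq.
have /rad /dvdpP [G ->] : a w c %| F * F.
  apply: sub; last first.
    move=> w' c' hq' cc'; rewrite (hac w' w c' c) // => f; by rewrite cc cc'.
  have := cycle_poly_coef0 hc p0; have /dvdpP [q ->] := ap.
  by apply: contraNneq => a0; rewrite -horner_coef0 hornerM !horner_coef0 a0 mulr0.
apply: (ev_same hL hJ hc hc0 cc); have /and4P[_ wc _ _] := hc.
by rewrite (evM hL wc); apply: (idealMl hJ); apply: ev_cycle_ideal.
Qed.

End Ideal.

Lemma prod_nth (l : seq {poly K}) n : (size l <= n)%N ->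
  \prod_(i < n) nth 1 l i = \prod_(q <- l) q.
Proof.
move=> h; rewrite [RHS](big_nth 1) big_mkord [RHS](big_ord_widen n (fun i => nth 1 l i)) //.
rewrite [RHS]big_mkcond; apply: eq_bigr => i _; case: ltnP => // hi.
by rewrite nth_default.
Qed.

Lemma cond3_cond2 : cond3 r s -> cond2 r s v e es.
Proof.
move=> /cond3P h3 I hI; have hH := ideal_edge_closed hL hI.
have [cs hcs] := h3 _ hH (ideal_saturated hL hI).
have [p [hp hpc]] := cycle_poly hI.
(* The list [cs] may contain edge sequences that are not cycles, hence the choice. *)
have /choice [X hX] : forall c', exists x, I x /\ forall (J : A -> Prop) w c, is_ideal J ->
    qual_at (fun u => I (v u)) w c -> c =i c' -> J x -> J (ev w c (p w c)).
  move=> c'; have [[w0 [c0 [hq0 cc0]]]|hn] :=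
      EM (exists w c, qual_at (fun u => I (v u)) w c /\ c =i c'); last first.
    exists 0; split; first exact: (ideal0 hI).
    by move=> J w c hJ hq cc; case: hn; exists w, c.
  have [hc0 _ _] := hq0; exists (ev w0 c0 (p w0 c0)); split; first exact/(hp _ _ hc0).
  move=> J w c hJ [hc _ _] cc; have cc' : c0 =i c by move=> f; rewrite cc0 cc.
  by rewrite -(hpc _ _ _ _ hc0 hc cc'); apply: (ev_same hL hJ hc0 hc cc').
exists [seq X c | c <- cs]; split.
  by move=> x /List.in_map_iff [c' [<- _]]; case: (hX c').
set J := gen _; have hJ : is_ideal J by apply: gen_ideal.
have JI : Defs.subset J I.
  apply: gen_min => // y [|/List.in_map_iff [c' [<- _]]]; first exact: gr_sub.
  by case: (hX c').
have grJ y : gr I y -> J y by move=> h; apply: gen_sub; left.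
move=> x; split; last exact: JI.
apply: (sub_cycle_ideal hI hp hJ JI).
- by move=> u Iu; apply: grJ; apply: gr_v.
- by move=> u y hu hy Iy; apply: grJ; apply: gr_vH hu hy Iy.
- move=> w c hq; have [c' c'cs cc'] := hcs w c hq.
  apply: (proj2 (hX c')) hJ hq cc' _; apply: gen_sub; right.
  by apply/In_mem/map_f.
Qed.

Lemma cond3_cond1 : cond3 r s -> cond1 A.
Proof.
move=> /cond3P h3 I hI pI; have hH := ideal_edge_closed hL hI.
have [cs hcs] := h3 _ hH (ideal_saturated hL hI).
have [p [hp hpc]] := cycle_poly hI.
have /choice [dec hdec] : forall q : {poly K}, exists l : seq {poly K}, q != 0 ->
    (forall q', q' \in l -> radical q') /\ \prod_(q' <- l) q' = q.
  move=> q; have [->|q0] := eqVneq q 0; first by exists [::].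
  by have [l hl] := radical_factor q0; exists l.
have /choice [len hlen] : forall c', exists n, forall w c,
    qual_at (fun u => I (v u)) w c -> c =i c' -> (size (dec (p w c)) <= n)%N.
  move=> c'; have [[w0 [c0 [hq0 cc0]]]|hn] :=
      EM (exists w c, qual_at (fun u => I (v u)) w c /\ c =i c'); last first.
    by exists 0 => w c hq cc; case: hn; exists w, c.
  have [hc0 _ _] := hq0; exists (size (dec (p w0 c0))) => w c [hc _ _] cc.
  by rewrite (hpc _ _ _ _ hc hc0) // => f; rewrite cc cc0.
(* The successor keeps [N] positive, so that the product of the [N] factors is 0 where [p w c] is
   0. *)
pose N := (\sum_(c <- cs) len c).+1.
have hN w c : qual_at (fun u => I (v u)) w c -> (size (dec (p w c)) <= N)%N.
  move=> hq; have [c' c'cs cc'] := hcs w c hq.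
  apply: leq_trans (hlen _ _ _ hq cc') _; rewrite /N (big_rem c') //=.
  by rewrite leqW // leq_addr.
(* Shorter factorizations are padded with 1 to the common length. *)
pose G i w c : {poly K} := if p w c == 0 then 0 else nth 1 (dec (p w c)) i.
have Ginv i w w' c c' : qual_at (fun u => I (v u)) w c -> qual_at (fun u => I (v u)) w' c' ->
    c =i c' -> G i w c = G i w' c'.
  by move=> [hc _ _] [hc' _ _] cc'; rewrite /G (hpc _ _ _ _ hc hc' cc').
have Gprod w c : qual_at (fun u => I (v u)) w c -> \prod_(i < N) G i w c = p w c.
  move=> hq; rewrite /G; case: eqVneq => [p0|p0].
    by rewrite big_const_ord iterS mul0r.
  by rewrite prod_nth ?hN //; case: (hdec _ p0).
have Grad i w c : qual_at (fun u => I (v u)) w c ->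
    G i w c = 0 \/ [/\ p w c != 0, G i w c %| p w c & radical (G i w c)].
  move=> hq; rewrite /G; case: eqVneq => [p0|p0]; [by left | right].
  have [h1 h2] := hdec _ p0; case: (ltnP i (size (dec (p w c)))) => hi; last first.
    by rewrite nth_default //; split => //; [apply: dvd1p | apply: radical1].
  have hn : nth 1 (dec (p w c)) i \in dec (p w c) by rewrite mem_nth.
  by split => //; [rewrite -{2}h2 (big_rem _ hn) /= dvdp_mulr | apply: h1].
pose Q i := cycle_ideal I (G i).
have hQ i : is_ideal (Q i) by apply: cycle_ideal_ideal.
pose full : A -> Prop := fun=> True.
pose X n := foldl (@iprod K A) full (mkseq Q n).
have XS n : X n.+1 = iprod (X n) (Q n) by rewrite /X mkseqS foldl_rcons.
have hX n : is_ideal (X n) by apply: foldl_iprod_ideal; split.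
have XQ n : Defs.subset (X n.+1) (cycle_ideal I (fun w c => \prod_(i < n.+1) G i w c)).
  elim: n => [|n IH].
    rewrite XS => x /(iprod_subr (hQ 0)); apply: cycle_ideal_sub.
    - exact: cycle_ideal_ideal.
    - by move=> u Iu; apply: gr_cycle_ideal; apply: gr_v.
    - by move=> u y hu hy Iy; apply: gr_cycle_ideal; apply: gr_vH hu hy Iy.
    - move=> w c hq; have := ev_cycle_ideal (a := fun w c => \prod_(i < 1) G i w c) hq.
      by rewrite big_ord1.
  rewrite XS => x /(iprod_mono IH (fun y h => h)).
  have -> : (fun w c => \prod_(i < n.+2) G i w c) =
      (fun w c => (\prod_(i < n.+1) G i w c) * G n.+1 w c).
    by apply/funext => w; apply/funext => c; rewrite big_ord_recr.
  apply: (cycle_idealM hI hp) => [w c hq|w w' c c']; last exact: Ginv.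
  rewrite /G; case: eqVneq => [p0|p0]; [left | by right].
  by rewrite big_const_ord iterS mul0r.
have XI : Defs.subset (X N) I.
  move=> x /XQ; apply: (cycle_idealP hI hp) => w c hq; by rewrite Gprod.
(* Vertices and elements v^H are idempotent, so they survive in every product of ideals that contain
   them. *)
have Xidem n y : y ** y = y -> gr I y -> X n y.
  move=> yy gy; elim: n => [|n IH]; first by [].
  by rewrite XS -yy; apply: iprodM => //; apply: gr_cycle_ideal.
have Xev n w c : qual_at (fun u => I (v u)) w c -> X n (ev w c (\prod_(i < n) G i w c)).
  move=> hq; have [hc _ _] := hq; have /and4P[_ wc _ _] := hc.
  elim: n => [|n IH]; first by [].
  by rewrite XS big_ord_recr /= (evM hL wc); apply: iprodM => //; apply: ev_cycle_ideal.
have IX : Defs.subset I (X N).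
  apply: (sub_cycle_ideal hI hp (hX N) XI).
  - by move=> u Iu; apply: Xidem; [apply: (vv hL) | apply: gr_v].
  - move=> u y hu hy Iy; apply: Xidem; first exact: (is_vH_idem hL hy).
    exact: gr_vH hu hy Iy.
  - by move=> w c hq; rewrite -(Gprod w c hq); apply: Xev.
apply: (@prod_of_semiprimes_or_full K A (mkseq Q N)) => //.
- exact: (iprod_full hL).
- move=> J hJ; have [i [<- _]] := (List.in_map_iff Q (iota 0 N) J).1 hJ.
  have [pQ|nQ] := EM (Defs.proper (Q i)); [left | right].
    apply: (semiprime_criterion hL) => //.
    exact: (cycle_ideal_radical hI hp (Grad i) (Ginv i)).
  move=> x; split=> // _; apply: contrapT => nx; apply: nQ; by exists x.
- by move=> x; split; [apply: IX | apply: XI].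
Qed.

End Converse.

Theorem theorem5p9 (K : fieldType) (E0 E1 : Type) (r s : E1 -> E0)
  (hE0 : inhabited E0) (A : nalg K) (v : E0 -> A) (e es : E1 -> A)
  (hL : is_LPA r s v e es) :
  (cond1 A <-> cond2 r s v e es) /\ (cond2 r s v e es <-> cond3 r s).
Proof.
(* Classical logic equips both types with decidable equality. *)
pose F0 : eqType := {classic E0}; pose F1 : eqType := {classic E1}.
have h13 : cond1 A -> cond3 r s := @cond1_cond3 K F0 F1 r s A v e es hL.
have h23 : cond2 r s v e es -> cond3 r s := @cond2_cond3 K F0 F1 r s A v e es hL.
have h31 : cond3 r s -> cond1 A := @cond3_cond1 K F0 F1 r s A v e es hL.
have h32 : cond3 r s -> cond2 r s v e es := @cond3_cond2 K F0 F1 r s A v e es hL.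
by split; split; auto.
Qed.
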